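(* There exist constants $c,C>0$ such that the following holds. Let $n\ge 6$, $d\ge1$, and let $\boldsymbol\sigma=(\sigma_1,\dots,\sigma_n)$ be positive noise levels satisfying $$\frac{\max_i\sigma_i^2}{\min_i\sigma_i^2}-1\le\frac14\sqrt{\frac{\log n}{d}}.$$ Let $\bar\Theta_\kappa=\{\boldsymbol\theta\in(\mathbb R^d)^n:\ \bar\kappa(\boldsymbol\theta,\boldsymbol\sigma)\ge\kappa\}$. If $\kappa<\frac18\max\{(\log n)^{1/2},(c\,d\log n)^{1/4}\}$, then $$\inf_{\hat\pi}\ \max_{\pi^*\in\mathfrak S_n}\ \sup_{\boldsymbol\theta\in\bar\Theta_\kappa}\mathbf P_{\boldsymbol\theta,\boldsymbol\sigma,\pi^*}(\hat\pi\ne\pi^* )>C,$$ where the infimum is over all estimators $\hat\pi$ (measurable functions of the data with values in $\mathfrak S_n$).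
   Context: Model: integers $n\ge2$, $d\ge1$. Unknown parameters: $\boldsymbol\theta=(\theta_1,\dots,\theta_n)$ with $\theta_i\in\mathbb R^d$, noise levels $\boldsymbol\sigma=(\sigma_1,\dots,\sigma_n)$ with $\sigma_i>0$, and a permutation $\pi^*\in\mathfrak S_n$ (the symmetric group on $\{1,\dots,n\}$). One observes $X_i=\theta_i+\sigma_i\xi_i$, $X_i^\#=\theta_{\pi^*(i)}+\sigma_i^\#\xi_i^\#$, $i=1,\dots,n$, where $\sigma_i^\#=\sigma_{\pi^*(i)}$ and $\xi_1,\dots,\xi_n,\xi_1^\#,\dots,\xi_n^\#$ are i.i.d. $\mathcal N(0,I_d)$. The law of the data is $\mathbf P_{\boldsymbol\theta,\boldsymbol\sigma,\pi^*}$. Relative separation distance: $\bar\kappa(\boldsymbol\theta,\boldsymbol\sigma)=\min_{i\ne j}\frac{\|\theta_i-\theta_j\|}{(\sigma_i^2+\sigma_j^2)^{1/2}}$. *)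

(* Defs.v *)
From HB Require Import structures.
From mathcomp Require Import all_boot all_order all_algebra fingroup perm.
From mathcomp Require Import all_classical all_reals all_analysis.
Set Implicit Arguments. Unset Strict Implicit. Unset Printing Implicit Defensive.
Import Order.TTheory GRing.Theory Num.Theory.
Local Open Scope classical_set_scope.
Local Open Scope ring_scope.


Definition eucl_norm {R : realType} (d : nat) (v : 'I_d -> R) : R :=
  Num.sqrt (\sum_(k < d) v k ^+ 2).

(* relative separation distance  min_{i<>j} |theta_i - theta_j| / sqrt(s_i^2 + s_j^2),
   as an extended real (it is finite as soon as n >= 2). *)
Definition kappa_bar {R : realType} (n d : nat) (theta : 'I_n -> 'I_d -> R) (sigma : 'I_n -> R)
  : \bar R :=
  \big[Order.min/+oo%E]_(ij : 'I_n * 'I_n | ij.1 != ij.2)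
     ((eucl_norm (fun k => theta ij.1 k - theta ij.2 k)
       / Num.sqrt (sigma ij.1 ^+ 2 + sigma ij.2 ^+ 2))%:E).

Definition Theta_bar {R : realType} (n d : nat) (sigma : 'I_n -> R) (kappa : R)
  : set ('I_n -> 'I_d -> R) :=
  [set theta | (kappa%:E <= kappa_bar theta sigma)%E].

(* max_i sigma_i^2 and min_i sigma_i^2 (the default value of the min is one of the
   sigma_i^2 whenever n >= 1 and all sigma_i > 0, so it is the true minimum). *)
Definition sig2_max {R : realType} (n : nat) (sigma : 'I_n -> R) : R :=
  \big[Num.max/0]_(i < n) sigma i ^+ 2.
Definition sig2_min {R : realType} (n : nat) (sigma : 'I_n -> R) : R :=
  \big[Num.min/sig2_max sigma]_(i < n) sigma i ^+ 2.

Definition data_space (R : realType) (n d : nat) := (('I_n -> 'I_d -> R) * ('I_n -> 'I_d -> R))%type.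

(* Borel sigma-algebra on (R^d)^n x (R^d)^n = R^{2nd}: generated by the coordinates. *)
Definition data_sigma {R : realType} (n d : nat) : set (set (data_space R n d)) :=
  <<s [set A | exists (b : bool) (i : 'I_n) (k : 'I_d) (B : set R),
          measurable B /\
          A = (fun x : data_space R n d => (if b then x.2 else x.1) i k) @^-1` B] >>.

Definition estimator {R : realType} (n d : nat) (f : data_space R n d -> {perm 'I_n}) : Prop :=
  forall s : {perm 'I_n}, data_sigma [set x | f x = s].

(* noise (false, i, k) = k-th coordinate of xi_i, noise (true, i, k) = of xi#_i;
   they are i.i.d. N(0,1): their joint law is the product of standard normals. *)
Definition iid_std_normal {R : realType} (dO : measure_display) (Omega : measurableType dO)
  (P : probability Omega R) (n d : nat) (noise : bool -> 'I_n -> 'I_d -> Omega -> R)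
  : Prop :=
  (forall b i k, measurable_fun setT (noise b i k)) /\
  (forall B : bool * 'I_n * 'I_d -> set R, (forall j, measurable (B j)) ->
     P (\bigcap_(j in [set: bool * 'I_n * 'I_d]) (noise j.1.1 j.1.2 j.2 @^-1` B j))
     = (\prod_(j : bool * 'I_n * 'I_d) normal_prob 0 1 (B j))%E).

Definition data {R : realType} (dO : measure_display) (Omega : measurableType dO) (n d : nat)
  (noise : bool -> 'I_n -> 'I_d -> Omega -> R)
  (theta : 'I_n -> 'I_d -> R) (sigma : 'I_n -> R) (pi_star : {perm 'I_n})
  (w : Omega) : data_space R n d :=
  (fun i k => theta i k + sigma i * noise false i k w,
   fun i k => theta (pi_star i) k + sigma (pi_star i) * noise true i k w).

Definition err_prob {R : realType} (dO : measure_display) (Omega : measurableType dO)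
  (P : probability Omega R) (n d : nat) (noise : bool -> 'I_n -> 'I_d -> Omega -> R)
  (pihat : data_space R n d -> {perm 'I_n})
  (theta : 'I_n -> 'I_d -> R) (sigma : 'I_n -> R) (pi_star : {perm 'I_n}) : \bar R :=
  P [set w | pihat (data noise theta sigma pi_star w) != pi_star].

Definition minimax_risk {R : realType} (dO : measure_display) (Omega : measurableType dO)
  (P : probability Omega R) (n d : nat) (noise : bool -> 'I_n -> 'I_d -> Omega -> R)
  (sigma : 'I_n -> R) (kappa : R) : \bar R :=
  ereal_inf [set (\big[Order.max/-oo%E]_(pi_star : {perm 'I_n})
                    ereal_sup [set err_prob P noise pihat theta sigma pi_star
                              | theta in @Theta_bar R n d sigma kappa])
            | pihat in [set f | estimator f]].

(* Main.v *)
Require Import Defs.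
From HB Require Import structures.
From mathcomp Require Import all_boot all_order all_algebra fingroup perm.
From mathcomp Require Import all_classical all_reals all_analysis.
From mathcomp Require Import measurable_realfun ring lra.
Set Implicit Arguments. Unset Strict Implicit. Unset Printing Implicit Defensive.
Import Order.TTheory GRing.Theory Num.Theory.
Local Open Scope classical_set_scope.
Local Open Scope ring_scope.

(* Items are paired and each pair (i, j) is given means
   L v + eps alpha s_i^2 and L v - eps alpha s_j^2, coordinate by coordinate,
   with independent uniform signs eps; L is so large that distinct pairs are far
   apart, and alpha makes the relative distance inside a pair equal to kappa.
   Under the uniform prior on the set of exchanged pairs, the likelihood factors
   over the pairs, so the success probability of any estimator is at most the
   product over the pairs of (1/2) int max(p0, p1), where p0, p1 are the laws of
   a pair, averaged over the signs, without and with exchange. This factor is at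
   most 1 - rho^2/4, with rho the Hellinger affinity of p0 and p1, and rho is the
   d-th power of an affinity in one coordinate.
   Weighting the perturbation of an item by its variance makes the log-likelihood
   ratio of the perturbation linear in the differences u, v of the two samples:
   one coordinate of p0, p1 is a Gaussian density times cosh(u +- v). Then
     sqrt (cosh (u + v) cosh (u - v)) = sqrt (X^2 + Y^2 - 1),
   X = cosh u, Y = cosh v, is at least X, which settles kappa^2 <= log n / 64, and
   at least 2X + 2Y - XY - 2, which settles kappa^4 <= d log n / 4096. In both
   cases rho^2 >= 1/n, and about n/2 pairs leave a constant probability of
   error. *)

(** * Densities and affine images of Gaussian laws *)

Section density.
Context d (T : measurableType d) (R : realType).
Implicit Types (mu nu : {measure set T -> \bar R}) (g : T -> R).
Local Open Scope ereal_scope.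

Lemma density_measure mu g : measurable_fun setT g -> (forall x, (0 <= g x)%R) ->
  exists m : {measure set T -> \bar R},
    forall A, m A = \int[mu]_(x in A) (g x)%:E.
Proof.
move=> mg g0; pose m A := \int[mu]_(x in A) (g x)%:E.
have m0 : m set0 = 0 by rewrite /m integral_set0.
have mge0 A : 0 <= m A by apply: integral_ge0 => x _; rewrite lee_fin.
have madd : semi_sigma_additive m.
  move=> F mF tF mUF; rewrite /m ge0_integral_bigcup//=.
  - apply: is_cvg_ereal_nneg_natsum_cond => n _ _; exact: mge0.
  - by apply/measurable_EFinP; exact: measurable_funS mg.
  - by move=> x _; rewrite lee_fin.
pose mix := isMeasure.Build _ _ _ m m0 mge0 madd.
by exists (HB.pack_for {measure set T -> \bar R} m mix).
Qed.

Import HBNNSimple.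

(** Both sides are limits along the same increasing simple functions below [h]. Monotone convergence
    thus reduces the claim to indicators of level sets, where it is the hypothesis on [nu]. *)
Lemma ge0_integral_density mu nu g (h : T -> R) :
  measurable_fun setT g -> (forall x, (0 <= g x)%R) ->
  measurable_fun setT h -> (forall x, (0 <= h x)%R) ->
  (forall A, measurable A -> nu A = \int[mu]_(x in A) (g x)%:E) ->
  \int[nu]_x (h x)%:E = \int[mu]_x (h x * g x)%:E.
Proof.
move=> mg g0 mh h0 nuE.
have mEh : measurable_fun setT (EFin \o h) by exact/measurable_EFinP.
pose f_ := nnsfun_approx measurableT mEh.
transitivity (limn (fun n => \int[nu]_x (f_ n x)%:E)).
  rewrite -monotone_convergence//.
  - apply: eq_integral => y _; apply/esym/cvg_lim => //.
    by apply: (cvg_nnsfun_approx measurableT mEh) => // *; rewrite lee_fin.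
  - by move=> n; exact/measurable_EFinP/measurable_funP.
  - by move=> n y _; rewrite lee_fin.
  - by move=> y _ m n mn; rewrite lee_fin; exact/lefP/nd_nnsfun_approx.
rewrite [X in limn X](_ : _ = (fun n => \int[mu]_x (f_ n x * g x)%:E)).
  rewrite -monotone_convergence//; last 3 first.
  - by move=> n; apply/measurable_EFinP/measurable_funM.
  - by move=> n x _; rewrite lee_fin mulr_ge0.
  - move=> x _ m n mn; rewrite lee_fin ler_wpM2r//.
    exact/lefP/nd_nnsfun_approx.
  apply: eq_integral => x _ /=; apply/cvg_lim => //.
  under eq_fun do rewrite EFinM.
  rewrite EFinM; apply: cvgeZr => //.
  by apply: (cvg_nnsfun_approx measurableT mEh) => // *; rewrite lee_fin.
apply/funext => n.
rewrite integralT_nnsfun sintegralE.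
transitivity (\sum_(k \in range (f_ n))
    \int[mu]_x (k * \1_(f_ n @^-1` [set k]) x * g x)%:E).
  apply: eq_fsbigr => r; rewrite inE => -[t _ rE].
  have r0 : (0 <= r)%R by rewrite -rE.
  rewrite nuE//= integral_mkcond/= -ge0_integralZl//=; last 2 first.
  - apply: (measurable_restrictT (EFin \o g) _).1 => //.
    by apply/measurable_EFinP; exact: measurable_funS mg.
  - by move=> x _; rewrite patchE; case: ifP => // _; rewrite lee_fin.
  apply: eq_integral => x _; rewrite patchE indicE.
  by case: ifP => _; rewrite -EFinM ?mulr1// !mulr0 mul0r.
rewrite -ge0_integral_fsum//.
- apply: eq_integral => x _; rewrite fsumEFin// [in RHS]fimfunE.
  by rewrite -mulr_fsuml.
- by move=> r; apply/measurable_EFinP/measurable_funM => //; exact: measurable_funM.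
- move=> r x _; rewrite EFinM mule_ge0 ?lee_fin// .
  rewrite -lee_fin; exact: nnfun_muleindic_ge0.
Qed.

End density.

Section normal_affine.
Context (R : realType).
Implicit Types (m s x : R) (B : set R).
Local Notation mu := (@lebesgue_measure R).

Lemma measurable_affine m s : measurable_fun setT (fun x : R => m + s * x).
Proof. by apply: measurable_funD => //; exact: measurable_funM. Qed.

(** The pushforward of Lebesgue measure, scaled by [s], gives each half-open interval its length,
    and Lebesgue measure is the only measure that does so. *)
Lemma lebesgue_measure_affine m s (A : set R) : 0 < s -> measurable A ->
  mu A = (s%:E * mu ((fun x : R => m + s * x)%R @^-1` A))%E.
Proof.
move=> s0 mA; pose phi : measurableTypeR R -> measurableTypeR R := fun x => m + s * x.
have mphi : measurable_fun setT phi by exact: measurable_affine.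
pose mix := isMeasurableFun.Build _ _ _ _ phi mphi.
pose phi' : {mfun measurableTypeR R >-> measurableTypeR R} := HB.pack phi mix.
rewrite (lebesgue_measure_unique
  (mu := mscale (NngNum (ltW s0)) (pushforward mu phi')))//.
move=> _ [[a b] _ <-] /=; rewrite /mscale/= /pushforward.
have -> : phi @^-1` `]a, b] = `](a - m) / s, (b - m) / s]%classic.
  apply/seteqP; split => x /=; rewrite !in_itv/= ltr_pdivrMr// ler_pdivlMr//;
    by rewrite ltrBlDl lerBrDl [x * s]mulrC.
rewrite !lebesgue_measure_itv/= !lte_fin ltr_pM2r ?invr_gt0// ltrD2r.
case: ifPn => _; last by rewrite mule0.
rewrite -EFinD -[in RHS]EFinD -EFinM; congr EFin; field.
by rewrite gt_eqF.
Qed.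

Lemma normal_pdf_affine m s x : 0 < s ->
  s * normal_pdf m s (m + s * x) = normal_pdf 0 1 x.
Proof.
move=> s0; rewrite !normal_pdfE ?gt_eqF// /normal_peak /normal_fun.
have -> : m + s * x - m = s * x by ring.
rewrite subr0 mulrA; congr (_ * _).
  rewrite expr1n mul1r -mulrnAr sqrtrM ?sqr_ge0// sqrtr_sqr gtr0_norm//.
  by rewrite invfM mulrA divff ?gt_eqF// mul1r.
congr expR; field; rewrite gt_eqF//.
Qed.

Lemma normal_prob_affine m s B : 0 < s -> measurable B ->
  normal_prob 0 1 ((fun x : R => m + s * x) @^-1` B) = normal_prob m s B.
Proof.
move=> s0 mB; pose phi : measurableTypeR R -> measurableTypeR R :=
  fun x => m + s * x.
have mphi : measurable_fun setT phi by exact: measurable_affine.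
pose mix := isMeasurableFun.Build _ _ _ _ phi mphi.
pose phi' : {mfun measurableTypeR R >-> measurableTypeR R} := HB.pack phi mix.
have mpdf : measurable_fun B (fun x => (normal_pdf m s x)%:E).
  apply/measurable_EFinP; apply: measurable_funTS.
  exact: measurable_normal_pdf.
rewrite /normal_prob.
rewrite [RHS](eq_measure_integral
  (mscale (NngNum (ltW s0)) (pushforward mu phi'))); last first.
  by move=> A mA _; exact: (lebesgue_measure_affine m s0 mA).
rewrite ge0_integral_mscale//; last first.
  by move=> x _; rewrite lee_fin normal_pdf_ge0.
rewrite ge0_integral_pushforward//; last first.
  by move=> x _; rewrite lee_fin normal_pdf_ge0.
rewrite -ge0_integralZl//=.
- by apply: eq_integral => x _; rewrite -EFinM normal_pdf_affine.
- by rewrite -[X in measurable X]setTI; exact: (mphi measurableT _ mB).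
- apply/measurable_EFinP/measurable_funTS; apply: measurableT_comp => //.
  exact: measurable_normal_pdf.
- by move=> x _; rewrite lee_fin normal_pdf_ge0.
by rewrite lee_fin ltW.
Qed.

Lemma normal_pdf_gt0 m s x : s != 0 -> 0 < normal_pdf m s x.
Proof. by move=> s0; rewrite normal_pdfE// mulr_gt0 ?normal_peak_gt0 ?expR_gt0. Qed.

Lemma measurable_normal_pdf_inv m s :
  s != 0 -> measurable_fun setT (fun x => (normal_pdf m s x)^-1).
Proof.
move=> s0; rewrite [X in measurable_fun _ X](_ : _ =
    fun x => (normal_peak s)^-1 * expR ((x - m) ^+ 2 / (s ^+ 2 *+ 2))).
  apply: measurable_funM => //; apply: measurableT_comp => //.
  apply: measurable_funM => //; apply: measurable_funX.
  exact: measurable_funB.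
by apply/funext => x; rewrite normal_pdfE// invfM -expRN mulNr opprK.
Qed.

(** Weighting by the inverse standard density turns the standard normal law back into Lebesgue
    measure. Any density can then be integrated over the noise space as a likelihood ratio. *)
Lemma integral_normal_prob_div01 (h : R -> R) :
  measurable_fun setT h -> (forall x, 0 <= h x) ->
  (\int[normal_prob 0 1]_x (h x / normal_pdf 0 1 x)%:E = \int[mu]_x (h x)%:E)%E.
Proof.
move=> mh h0; rewrite (@ge0_integral_density _ _ _ mu _ (normal_pdf 0 1)).
- by apply: eq_integral => x _; rewrite divfK// gt_eqF// normal_pdf_gt0.
- exact: measurable_normal_pdf.
- by move=> x; rewrite normal_pdf_ge0.
- apply: measurable_funM => //; exact: measurable_normal_pdf_inv.
- by move=> x; rewrite divr_ge0 ?normal_pdf_ge0.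
by [].
Qed.

End normal_affine.

(** * Independence *)

Section independence.
Context dO (Omega : measurableType dO) (R : realType) (P : probability Omega R).
Context (J : finType) (X : J -> Omega -> R).
Hypothesis mX : forall j, measurable_fun setT (X j).
Hypothesis indepX : forall B : J -> set R, (forall j, measurable (B j)) ->
  P (\bigcap_(j in [set: J]) (X j @^-1` B j)) = (\prod_j P (X j @^-1` B j))%E.
Implicit Types S : {set J}.
Local Open Scope ereal_scope.

Definition cylinder S : set (set Omega) :=
  [set A | exists2 B : J -> set R, (forall j, measurable (B j)) &
           A = \bigcap_(j in [set` S]) (X j @^-1` B j)].

(** [Omega] with the sigma-algebra generated by the coordinates in [S]: measurability on this type
    expresses that a function depends on these coordinates only. *)
Definition cylType S := g_sigma_algebraType (cylinder S).

Let mpreim j (B : set R) : measurable B -> measurable (X j @^-1` B).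
Proof. by move=> mB; rewrite -[X in measurable X]setTI; exact: mX. Qed.

Let cylinder_measurable S : cylinder S `<=` measurable.
Proof.
move=> _ [B mB ->]; apply: fin_bigcap_measurable => // j _; exact: mpreim.
Qed.

Let cylinderT S : cylinder S setT.
Proof.
exists (fun=> setT) => //; apply/esym; rewrite -subTset => w _ j _.
by rewrite preimage_setT.
Qed.

Let cylinderI S : setI_closed (cylinder S).
Proof.
move=> _ _ [B mB ->] [C mC ->]; exists (fun j => B j `&` C j).
  by move=> j; exact: measurableI.
by rewrite -bigcapI; apply: eq_bigcapr => j _; rewrite preimage_setI.
Qed.

Let cylinderE S (B : J -> set R) : (forall j, measurable (B j)) ->
  \bigcap_(j in [set` S]) (X j @^-1` B j) =
  \bigcap_(j in [set: J]) (X j @^-1` (if j \in S then B j else setT)).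
Proof.
move=> mB; apply/seteqP; split => w h j /=.
  by move=> _; case: ifPn => // jS; exact: h.
by move=> jS; have := h j I; rewrite jS.
Qed.

Let mif S (B : J -> set R) : (forall j, measurable (B j)) ->
  forall j, measurable (if j \in S then B j else setT).
Proof. by move=> mB j; case: ifP. Qed.

Let indep_cylinder S S' A A' : [disjoint S & S']%B ->
  cylinder S A -> cylinder S' A' -> P (A `&` A') = P A * P A'.
Proof.
move=> dS [B mB ->] [C mC ->]; rewrite !cylinderE//.
rewrite -bigcapI !indepX; do ?exact: mif.
rewrite (eq_bigcapr (G := fun j => X j @^-1`
    ((if j \in S then B j else setT) `&` (if j \in S' then C j else setT))));
  last by move=> j _; rewrite preimage_setI.
rewrite indepX; last by move=> j; apply: measurableI; exact: mif.
rewrite -big_split/=; apply: eq_bigr => j _.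
have [jS|jS] := boolP (j \in S).
  by rewrite (disjointFr dS jS) setIT preimage_setT probability_setT mule1.
by rewrite setTI preimage_setT probability_setT mul1e.
Qed.

(** As functions of [A], both sides are finite measures that agree on the pi-system [G], hence on
    what it generates. Applied to each argument in turn, this carries independence from cylinders to
    their sigma-algebras. *)
Let pi_ext (G : set (set Omega)) A' : G `<=` measurable -> setI_closed G ->
  G setT -> measurable A' ->
  (forall A, G A -> P (A `&` A') = P A * P A') ->
  forall A, <<s G >> A -> P (A `&` A') = P A * P A'.
Proof.
move=> Gm GI GT mA' GE A GA.
have r0 : (0 <= fine (P A'))%R by rewrite fine_ge0.
have PA' : P A' = (fine (P A'))%:E by rewrite fineK// fin_num_measure.
have mE B : mscale (NngNum r0) P B = P B * P A'.
  by rewrite muleC; exact: (congr1 (fun z => z * P B) (esym PA')).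
rewrite -mE.
rewrite -[LHS]/(mrestr P mA' A).
apply: (g_sigma_algebra_measure_unique G Gm (fun=> setT)) => //.
- by rewrite -subTset => x _; exists 0%N.
- by move=> B GB; apply: (etrans (GE _ GB)); apply/esym; exact: mE.
- by move=> _; rewrite /= /mrestr setTI PA' ltry.
Qed.

Let sub_sigma S : <<s cylinder S >> `<=` measurable.
Proof.
apply: smallest_sub; [exact: sigma_algebra_measurable|exact: cylinder_measurable].
Qed.

Let indep_sigma S S' A A' : [disjoint S & S']%B ->
  <<s cylinder S >> A -> <<s cylinder S' >> A' -> P (A `&` A') = P A * P A'.
Proof.
move=> dS sA sA'; have mA' := sub_sigma sA'.
apply: pi_ext sA => // B cB; have mB := cylinder_measurable cB.
rewrite setIC muleC; apply: pi_ext sA' => // B' cB'.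
by rewrite setIC muleC; exact: indep_cylinder dS cB cB'.
Qed.

Lemma cylinder_coord S j : j \in S -> measurable_fun setT (X j : cylType S -> R).
Proof.
move=> jS _ B mB; rewrite setTI; apply: sub_sigma_algebra.
exists (fun k => if k == j then B else setT); first by move=> k; case: ifP.
apply/seteqP; split => w /= h; last by have := h j jS; rewrite eqxx.
by move=> k _; case: ifPn => // /eqP ->.
Qed.

Let cylinder_sub S S' : S \subset S' -> cylinder S `<=` cylinder S'.
Proof.
move=> SS' _ [B mB ->]; exists (fun j => if j \in S then B j else setT).
  exact: mif.
apply/seteqP; split => w h j /= jS; first by case: ifPn => // /h.
by have := h j (fintype.subsetP SS' _ jS); rewrite jS.
Qed.

Lemma cylType_sub S S' (F : Omega -> R) : S \subset S' ->
  measurable_fun setT (F : cylType S -> R) ->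
  measurable_fun setT (F : cylType S' -> R).
Proof.
move=> SS' mF _ B mB; have := mF measurableT B mB.
by apply: sub_smallest2r; [exact: smallest_sigma_algebra|exact: cylinder_sub].
Qed.

Lemma cylType_measurable S (F : Omega -> R) :
  measurable_fun setT (F : cylType S -> R) -> measurable_fun setT F.
Proof. by move=> mF _ B mB; apply: (sub_sigma (mF measurableT B mB)). Qed.

(** By independence, the diagonal map into the product of the two coarser spaces has a product law;
    Tonelli's theorem then separates the factors. *)
Lemma integral_indep2 S S' (F G : Omega -> R) : [disjoint S & S']%B ->
  measurable_fun setT (F : cylType S -> R) ->
  measurable_fun setT (G : cylType S' -> R) ->
  (forall w, 0 <= F w)%R -> (forall w, 0 <= G w)%R ->
  \int[P]_w (F w * G w)%:E = \int[P]_w (F w)%:E * \int[P]_w (G w)%:E.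
Proof.
move=> dS mF mG F0 G0.
have mid U : measurable_fun setT (id : Omega -> cylType U).
  by move=> _ B mB; rewrite setTI; apply: (sub_sigma mB).
pose mixid U := isMeasurableFun.Build _ _ _ _ _ (mid U).
pose idm U : {mfun Omega >-> cylType U} := HB.pack (id : Omega -> cylType U) (mixid U).
pose pr w : cylType S * cylType S' := (w : cylType S, w : cylType S').
have mpr : measurable_fun (setT : set Omega) pr.
  by apply: measurable_fun_pair; exact: mid.
pose mixpr := isMeasurableFun.Build _ _ _ _ _ mpr.
pose prm : {mfun Omega >-> (cylType S * cylType S')%type} := HB.pack pr mixpr.
pose Q := distribution P (idm S). pose Q' := distribution P (idm S').
have prE : forall Z, measurable Z -> (Q \x Q') Z = distribution P prm Z.
  apply: product_measure_unique => A B mA mB.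
  exact: indep_sigma dS mA mB.
have mFG : measurable_fun setT
    (fun z : cylType S * cylType S' => (F z.1 * G z.2)%:E).
  apply/measurable_EFinP/measurable_funM.
    exact: (measurableT_comp mF measurable_fst).
  exact: (measurableT_comp mG measurable_snd).
transitivity (\int[distribution P prm]_z (F z.1 * G z.2)%:E).
  rewrite ge0_integral_distribution//.
  by move=> z; rewrite lee_fin mulr_ge0.
rewrite (eq_measure_integral (Q \x Q')); last first.
  by move=> Z mZ _; apply/esym; exact: prE.
rewrite fubini_tonelli1//; last first.
  by move=> z; rewrite lee_fin mulr_ge0.
rewrite /fubini_F /=.
have mEG : measurable_fun setT (fun y : cylType S' => (G y)%:E).
  exact/measurable_EFinP.
have mEF : measurable_fun setT (fun x : cylType S => (F x)%:E).
  exact/measurable_EFinP.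
have GQ : \int[P]_w (G w)%:E = \int[Q']_y (G y)%:E.
  by rewrite ge0_integral_distribution//; exact/measurable_EFinP.
have FQ : \int[P]_w (F w)%:E = \int[Q]_y (F y)%:E.
  by rewrite ge0_integral_distribution//; exact/measurable_EFinP.
rewrite GQ FQ -ge0_integralZr//=.
- apply: eq_integral => x _; under eq_integral do rewrite EFinM.
  rewrite ge0_integralZl//; last by rewrite lee_fin.
  by move=> y _; rewrite lee_fin.
- by move=> x _; rewrite lee_fin.
by apply: integral_ge0 => y _; rewrite lee_fin.
Qed.

Lemma integral_indep_prod (K : finType) (S : K -> {set J}) (F : K -> Omega -> R) :
  (forall k k', k != k' -> [disjoint S k & S k']%B) ->
  (forall k, measurable_fun setT (F k : cylType (S k) -> R)) ->
  (forall k w, 0 <= F k w)%R ->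
  \int[P]_w (\prod_k F k w)%:E = \prod_k \int[P]_w (F k w)%:E.
Proof.
move=> dS mF F0.
(* [U s] gathers the coordinates used by the factors indexed by [s]. The partial product depends on
   these only, so it is independent of the next factor. *)
pose U (s : seq K) := [set j | has (fun k => j \in S k) s]%SET.
have ms (s : seq K) : measurable_fun setT
    ((fun w => \prod_(k <- s) F k w)%R : cylType (U s) -> R).
  apply: measurable_prod => k ks; apply: cylType_sub (mF k).
  by apply/fintype.subsetP => j jS; rewrite inE; apply/hasP; exists k.
elim: (index_enum K) (index_enum_uniq K) => [_|k s IH /= /andP[ks us]].
  under eq_integral do rewrite big_nil.
  by rewrite big_nil integral_cst//= probability_setT mule1.
under eq_integral do rewrite big_cons.
rewrite big_cons -IH// (@integral_indep2 (S k) (U s))//.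
- rewrite disjoint_subset; apply/fintype.subsetP => j jS; rewrite !inE.
  apply/hasPn => k' k's; have kk' : k != k' by apply: contraNneq ks => ->.
  by rewrite (disjointFr (dS _ _ kk') jS).
- by move=> w; apply: prodr_ge0.
Qed.

End independence.

(** * The law of the data as a density with respect to the noise *)

Section pointed_data_space.
Import numFieldNormedType.Exports.

HB.instance Definition _ (R : realType) (n d : nat) :=
  Pointed.copy (data_space R n d)
    (('I_n -> 'I_d -> R) * ('I_n -> 'I_d -> R))%type.

End pointed_data_space.

Section data_law.
Context dO (Omega : measurableType dO) (R : realType) (P : probability Omega R).
Context (n d : nat) (noise : bool -> 'I_n -> 'I_d -> Omega -> R).
Hypothesis iid : iid_std_normal P noise.
Local Notation J := (bool * 'I_n * 'I_d)%type.

Definition coord (j : J) : Omega -> R := noise j.1.1 j.1.2 j.2.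

Lemma measurable_coord j : measurable_fun setT (coord j).
Proof. exact: iid.1. Qed.

Lemma coord_law j B : measurable B -> P (coord j @^-1` B) = normal_prob 0 1 B.
Proof.
move=> mB; pose C k := if k == j then B else setT.
have mC k : measurable (C k) by rewrite /C; case: ifP.
have <- : \bigcap_(k in [set: J]) (coord k @^-1` C k) = coord j @^-1` B.
  apply/seteqP; split => w /=; first by move=> /(_ j I); rewrite /C eqxx.
  by move=> h k _; rewrite /C; case: eqP => // ->.
rewrite /coord iid.2// (bigD1 j)//= /C eqxx big1 ?mule1// => k /negbTE ->.
by rewrite probability_setT.
Qed.

Lemma coord_indep (B : J -> set R) : (forall j, measurable (B j)) ->
  P (\bigcap_(j in [set: J]) (coord j @^-1` B j)) =
  (\prod_j P (coord j @^-1` B j))%E.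
Proof.
by move=> mB; rewrite iid.2//; apply: eq_bigr => j _; rewrite coord_law.
Qed.

Lemma integral_coord j (h : R -> R) :
  measurable_fun setT h -> (forall x, 0 <= h x) ->
  (\int[P]_w (h (coord j w) / normal_pdf 0 1 (coord j w))%:E =
   \int[lebesgue_measure]_x (h x)%:E)%E.
Proof.
move=> mh h0; rewrite -integral_normal_prob_div01//.
have mY : measurable_fun setT (coord j : Omega -> measurableTypeR R).
  exact: measurable_coord.
pose mix := isMeasurableFun.Build _ _ _ _ _ mY.
pose Y : {mfun Omega >-> measurableTypeR R} :=
  HB.pack (coord j : Omega -> measurableTypeR R) mix.
have mq : measurable_fun setT (fun x => (h x / normal_pdf 0 1 x)%:E).
  apply/measurable_EFinP; apply: measurable_funM => //.
  exact: measurable_normal_pdf_inv.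
transitivity (\int[distribution P Y]_x (h x / normal_pdf 0 1 x)%:E)%E.
  rewrite ge0_integral_distribution// => x.
  by rewrite lee_fin divr_ge0 ?normal_pdf_ge0.
by apply: eq_measure_integral => A mA _; exact: coord_law.
Qed.

(** Density of independent normal data relative to pure noise, evaluated at the noise itself. *)
Definition lik_ratio (mean sd : J -> R) (w : Omega) : R :=
  \prod_j (normal_pdf (mean j) (sd j) (coord j w) / normal_pdf 0 1 (coord j w)).

Lemma measurable_ratio m s j : measurable_fun setT
  (fun w => normal_pdf m s (coord j w) / normal_pdf 0 1 (coord j w)).
Proof.
apply: (measurableT_comp (f := fun x => normal_pdf m s x / normal_pdf 0 1 x)).
  apply: measurable_funM; first exact: measurable_normal_pdf.
  exact: measurable_normal_pdf_inv.
exact: measurable_coord.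
Qed.

Lemma measurable_lik_ratio mean sd : measurable_fun setT (lik_ratio mean sd).
Proof. by apply: measurable_prod => j _; exact: measurable_ratio. Qed.

Lemma lik_ratio_ge0 mean sd w : 0 <= lik_ratio mean sd w.
Proof. by apply: prodr_ge0 => j _; rewrite divr_ge0 ?normal_pdf_ge0. Qed.

Definition obs (j : J) (x : data_space R n d) : R :=
  (if j.1.1 then x.2 else x.1) j.1.2 j.2.

(** The events with measurable preimage form a sigma-algebra that contains the generators. *)
Lemma measurable_obs (Y : Omega -> data_space R n d) :
  (forall j, measurable_fun setT (fun w => obs j (Y w))) ->
  forall A, data_sigma A -> measurable (Y @^-1` A).
Proof.
move=> mY; apply: smallest_sub; last first.
  move=> _ [b [i [k [B [mB ->]]]]] /=.
  by have := mY (b, i, k) measurableT B mB; rewrite setTI.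
split => [|A mA|F mF] /=.
- by rewrite preimage_set0.
- by rewrite setTD preimage_setC; exact: measurableC.
by rewrite preimage_bigcup; exact: bigcupT_measurable.
Qed.

Definition noise_point (w : Omega) : data_space R n d :=
  (fun i k => noise false i k w, fun i k => noise true i k w).

Lemma obs_noise_point j w : obs j (noise_point w) = coord j w.
Proof. by case: j => [[[] i] k]. Qed.

Lemma measurable_noise_point A : data_sigma A -> measurable (noise_point @^-1` A).
Proof.
apply: measurable_obs => j; rewrite [X in measurable_fun _ X](_ : _ = coord j).
  exact: measurable_coord.
by apply/funext => w; rewrite obs_noise_point.
Qed.

(** Change of measure from data to noise: whatever the parameters, the probability of an event
    becomes an integral against one and the same [P]. Rectangles form a generating pi-system on
    which both sides factor over the coordinates. *)
Lemma law_lik_ratio (mean sd : J -> R) (Y : Omega -> data_space R n d) :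
  (forall j, 0 < sd j) ->
  (forall j w, obs j (Y w) = mean j + sd j * coord j w) ->
  forall A, data_sigma A ->
  P (Y @^-1` A) = (\int[P]_(w in noise_point @^-1` A) (lik_ratio mean sd w)%:E)%E.
Proof.
move=> sd0 YE A sA.
have mY : forall B, data_sigma B -> measurable (Y @^-1` B).
  apply: measurable_obs => j; under eq_fun do rewrite YE.
  apply: measurable_funD => //; apply: measurable_funM => //.
  exact: measurable_coord.
pose rect : set (set (data_space R n d)) :=
  [set A | exists2 B : J -> set R, (forall j, measurable (B j)) &
     A = \bigcap_(j in [set: J]) (obs j @^-1` B j)].
have rect_gen B : rect B -> data_sigma B.
  move=> [C mC ->].
  pose gen : set (set (data_space R n d)) :=
    [set A | exists (b : bool) (i : 'I_n) (k : 'I_d) (B : set R),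
      measurable B /\
      A = (fun x : data_space R n d => (if b then x.2 else x.1) i k) @^-1` B].
  apply: (fin_bigcap_measurable
    (F := fun j => obs j @^-1` C j : set (g_sigma_algebraType gen))) => //.
  move=> -[[b i] k] _; apply: sub_sigma_algebra.
  by exists b, i, k, (C (b, i, k)).
have gen_rect : @data_sigma R n d `<=` <<s rect >>.
  apply: sub_smallest2r; first exact: smallest_sigma_algebra.
  move=> _ [b [i [k [B [mB ->]]]]].
  exists (fun j => if j == (b, i, k) then B else setT).
    by move=> j; case: ifP.
  apply/seteqP; split => x /=; last by move=> /(_ (b, i, k) I); rewrite eqxx.
  by move=> h j _; case: eqP => // ->.
have rectI : setI_closed rect.
  move=> _ _ [B mB ->] [C mC ->]; exists (fun j => B j `&` C j).
    by move=> j; exact: measurableI.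
  by rewrite -bigcapI; apply: eq_bigcapr => j _; rewrite preimage_setI.
have rectT : rect setT.
  exists (fun=> setT) => //; apply/esym; rewrite -subTset => w _ j _.
  by rewrite preimage_setT.
have rect_sub : <<s rect >> `<=` @data_sigma R n d.
  apply: smallest_sub => //; exact: smallest_sigma_algebra.
pose T := g_sigma_algebraType rect.
have mTY : measurable_fun setT (Y : Omega -> T).
  by move=> _ B sB; rewrite setTI; exact: (mY _ (rect_sub _ sB)).
have mTN : measurable_fun setT (noise_point : Omega -> T).
  by move=> _ B sB; rewrite setTI; exact: (measurable_noise_point (rect_sub _ sB)).
pose mixY := isMeasurableFun.Build _ _ _ _ _ mTY.
pose mixN := isMeasurableFun.Build _ _ _ _ _ mTN.
pose fY : {mfun Omega >-> T} := HB.pack (Y : Omega -> T) mixY.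
pose fN : {mfun Omega >-> T} := HB.pack (noise_point : Omega -> T) mixN.
have [nu nuE] := density_measure P (measurable_lik_ratio mean sd)
  (lik_ratio_ge0 mean sd).
rewrite -nuE.
have rect_sigma : rect `<=` (@measurable _ T) by exact: sub_sigma_algebra.
have cover : \bigcup_(k in [set: nat]) (setT : set T) = setT.
  by rewrite -subTset => x _; exists 0%N.
have key : (forall B, rect B -> pushforward P fY B = pushforward nu fN B) ->
    (forall _ : nat, (pushforward P fY setT < +oo)%E) ->
    pushforward P fY A = pushforward nu fN A.
  move=> h1 h2.
  exact: (g_sigma_algebra_measure_unique (rect : set (set T)) rect_sigma
    (fun=> setT) (fun=> rectT) cover (pushforward P fY) (pushforward nu fN)
    rectI h1 h2 _ (gen_rect _ sA)).
apply: key.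
- move=> _ [B mB ->]; rewrite /pushforward /= nuE.
  rewrite !preimage_bigcap.
  transitivity (\prod_j normal_prob (mean j) (sd j) (B j))%E.
    rewrite (eq_bigcapr (G := fun j => coord j @^-1`
       ((fun x => mean j + sd j * x) @^-1` B j))); last first.
      by move=> j _; apply/seteqP; split => w /=; rewrite YE.
    rewrite iid.2; last first.
      move=> j; rewrite -[X in measurable X]setTI.
      exact: measurable_affine.
    by apply: eq_bigr => j _; rewrite normal_prob_affine.
  rewrite integral_mkcond/=.
  (* The indicator of the rectangle is absorbed into the factors, so that independence reduces the
     integral to single coordinates. *)
  pose g j x := \1_(B j) x * normal_pdf (mean j) (sd j) x.
  have mg j : measurable_fun setT (g j).
    apply: measurable_funM => //; exact: measurable_normal_pdf.
  have g0 j x : 0 <= g j x by rewrite mulr_ge0 ?normal_pdf_ge0.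
  transitivity (\int[P]_w
      (\prod_j (g j (coord j w) / normal_pdf 0 1 (coord j w)))%:E)%E; last first.
    apply: eq_integral => w _; rewrite patchE; case: ifPn.
      rewrite inE => wB; congr EFin; apply: eq_bigr => j _; rewrite /g.
      have := wB j I; rewrite /= obs_noise_point => wBj.
      by rewrite indicE mem_set// mul1r.
    rewrite notin_setE => wB.
    have [j wBj] : exists j, ~ B j (coord j w).
      apply/existsNP => wB'; apply: wB => j _ /=.
      by rewrite obs_noise_point.
    rewrite (bigD1 j)//= {1}/g indicE memNset// !mul0r//.
  rewrite (integral_indep_prod measurable_coord coord_indep (S := fun j => [set j]%SET)
    (F := fun j w => g j (coord j w) / normal_pdf 0 1 (coord j w)))//.
  + apply: eq_bigr => j _; rewrite integral_coord//.
    rewrite /normal_prob integral_mkcond; apply: eq_integral => x _.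
    by rewrite patchE /g indicE; case: ifP; rewrite ?mul1r ?mul0r.
  + by move=> k k' kk'; rewrite disjoints1 inE.
  + move=> j; apply: (measurableT_comp (f := fun x => g j x / normal_pdf 0 1 x)).
      by apply: measurable_funM => //; exact: measurable_normal_pdf_inv.
    by apply: cylinder_coord; rewrite inE.
  by move=> j w; rewrite divr_ge0 ?normal_pdf_ge0.
by move=> _; rewrite /pushforward/= preimage_setT probability_setT ltry.
Qed.

End data_law.

(** * One pair of items *)

Section gaussian_tilt.
Context (R : realType).
Implicit Types (m s t x : R).

(** A shift of the mean proportional to the variance is an exponential tilt whose slope [t] does not
    depend on [s]. This is why the means of a pair are perturbed in proportion to the variances. *)
Lemma normal_pdf_tilt m s t x : s != 0 ->
  normal_pdf (m + t * s ^+ 2) s x =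
  normal_pdf m s x * expR (t * (x - m)) * expR (- (t ^+ 2 * s ^+ 2 / 2)).
Proof.
move=> s0; rewrite !normal_pdfE// -!mulrA -!expRD; congr (_ * expR _).
by field.
Qed.

(** The shifted density has integral one, which gives the Gaussian moment generating function. *)
Lemma integral_normal_pdf_tilt m s t : s != 0 ->
  (\int[lebesgue_measure]_x (normal_pdf m s x * expR (t * (x - m)))%:E =
   (expR (t ^+ 2 * s ^+ 2 / 2))%:E)%E.
Proof.
move=> s0; rewrite -[RHS]mule1 -(integral_normal_pdf (m + t * s ^+ 2) s).
rewrite -ge0_integralZl//=.
- apply: eq_integral => x _; rewrite normal_pdf_tilt// -EFinM; congr EFin.
  by rewrite expRN; field; rewrite gt_eqF ?expR_gt0.
- by apply/measurable_EFinP; exact: measurable_normal_pdf.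
by move=> x _; rewrite lee_fin normal_pdf_ge0.
Qed.

(** Square of the Hellinger affinity of two normal laws with a common mean and these standard
    deviations. *)
Definition bhatt (s1 s2 : R) := 2 * s1 * s2 / (s1 ^+ 2 + s2 ^+ 2).

(** Root of the harmonic mean of the variances, since precisions are averaged in a geometric mean of
    Gaussian densities. *)
Definition hmean_sd (s1 s2 : R) :=
  Num.sqrt (2 * s1 ^+ 2 * s2 ^+ 2 / (s1 ^+ 2 + s2 ^+ 2)).

Lemma normal_peakE s : 0 < s -> normal_peak s = (s * Num.sqrt (pi *+ 2))^-1.
Proof.
by move=> s0; rewrite /normal_peak -mulrnAr sqrtrM ?sqr_ge0// sqrtr_sqr gtr0_norm.
Qed.

Lemma normal_pdf_gmean m s1 s2 x : 0 < s1 -> 0 < s2 ->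
  normal_pdf m s1 x * normal_pdf m s2 x =
  (Num.sqrt (bhatt s1 s2) * normal_pdf m (hmean_sd s1 s2) x) ^+ 2.
Proof.
move=> s10 s20.
have S0 : 0 < s1 ^+ 2 + s2 ^+ 2 by rewrite addr_gt0 ?exprn_gt0.
have b0 : 0 < bhatt s1 s2 by rewrite divr_gt0// !mulr_gt0.
have t20 : 0 < 2 * s1 ^+ 2 * s2 ^+ 2 / (s1 ^+ 2 + s2 ^+ 2).
  by rewrite divr_gt0// !mulr_gt0 ?exprn_gt0.
have t0 : 0 < hmean_sd s1 s2 by rewrite sqrtr_gt0.
rewrite !normal_pdfE ?gt_eqF// !normal_peakE//.
have t2E : hmean_sd s1 s2 ^+ 2 = 2 * s1 ^+ 2 * s2 ^+ 2 / (s1 ^+ 2 + s2 ^+ 2).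
  by rewrite sqr_sqrtr// ltW.
rewrite exprMn sqr_sqrtr ?ltW// exprMn exprVn exprMn t2E.
set q := Num.sqrt _; have q0 : 0 < q by rewrite sqrtr_gt0 pmulrn_lgt0// pi_gt0.
rewrite /normal_fun t2E -[X in _ = _ * (_ * X)]expRM_natl mulrACA -expRD mulrA.
congr (_ * expR _); last by field; rewrite !gt_eqF.
by rewrite /bhatt; field; rewrite !gt_eqF.
Qed.

End gaussian_tilt.

(** * Lower bounds for a product of hyperbolic cosines *)

Section cosh_bounds.
Context (R : realType).

(** The lower bound 2X + 2Y - XY - 2 on the root is a polynomial, so that for hyperbolic cosines it
    integrates exactly against Gaussian laws. Where it is negative, the claim is immediate. *)
Lemma sqrt_ge_prod_gap (X Y : R) : 1 <= X -> 1 <= Y ->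
  2 * X + 2 * Y <= Num.sqrt (X ^+ 2 + Y ^+ 2 - 1) + (X * Y + 2).
Proof.
move=> X1 Y1; rewrite -lerBlDr; have [h|h] := leP 0 (2 * X + 2 * Y - (X * Y + 2)).
  (* In the excesses p and q over 1, the difference of the squares factors as pq(2(p + q) - pq). *)
  have [p [p0 pE]] : exists p, 0 <= p /\ X = 1 + p.
    by exists (X - 1); split; [rewrite subr_ge0|ring].
  have [q [q0 qE]] : exists q, 0 <= q /\ Y = 1 + q.
    by exists (Y - 1); split; [rewrite subr_ge0|ring].
  subst X Y; have pq0 : 0 <= p * q by rewrite mulr_ge0.
  (* If p + q >= 1, then [h], which reads pq <= 1 + p + q, suffices; otherwise q < 1 gives pq <=
     p. *)
  have gap : 0 <= 2 * (p + q) - p * q.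
    have [pq1|pq1] := leP 1 (p + q); first by lra.
    have : p * q <= p by rewrite ler_piMr//; lra.
    by lra.
  rewrite -[leLHS]ger0_norm// -sqrtr_sqr ler_sqrt; last by nra.
  rewrite -subr_ge0.
  rewrite [X in 0 <= X](_ : _ = (p * q) * (2 * (p + q) - p * q)); last by ring.
  exact: mulr_ge0.
by rewrite (le_trans (ltW h))// sqrtr_ge0.
Qed.

Lemma sqrt_ge_left (X Y : R) : 0 <= X -> 1 <= Y ->
  X <= Num.sqrt (X ^+ 2 + Y ^+ 2 - 1).
Proof.
move=> X0 Y1; rewrite -[leLHS]ger0_norm// -sqrtr_sqr ler_sqrt; nra.
Qed.

Definition ch (u : R) := (expR u + expR (- u)) / 2.

Lemma ch_ge1 u : 1 <= ch u.
Proof.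
rewrite /ch expRN ler_pdivlMr// mul1r -subr_ge0.
rewrite [X in 0 <= X](_ : _ = (expR u - 1) ^+ 2 / expR u); last first.
  by field; rewrite gt_eqF ?expR_gt0.
by rewrite divr_ge0 ?sqr_ge0 ?expR_ge0.
Qed.

Lemma chDB u v : ch (u + v) * ch (u - v) = ch u ^+ 2 + ch v ^+ 2 - 1.
Proof.
rewrite /ch !opprD opprK !expRD !expRN; field.
by rewrite !gt_eqF ?expR_gt0.
Qed.

End cosh_bounds.

(** * Affinity of the two hypotheses on a pair, in one coordinate *)

Section matched_pair.
Context dO (Omega : measurableType dO) (R : realType) (P : probability Omega R).
Context (n d : nat) (noise : bool -> 'I_n -> 'I_d -> Omega -> R).
Hypothesis iid : iid_std_normal P noise.
Context (i1 i2 : 'I_n) (s1 s2 m al : R).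
Hypotheses (i12 : i1 != i2) (s1_gt0 : 0 < s1) (s2_gt0 : 0 < s2).
Implicit Types (e be r : bool) (q : bool * bool) (l : 'I_d).
Local Notation J := (bool * 'I_n * 'I_d)%type.
Local Notation crd := (coord noise).
Local Notation phi01 := (normal_pdf 0 1).

Definition sgb e : R := (-1) ^+ e.
Definition pair_sd r := if r then s2 else s1.
Definition pair_mean e r := m + sgb e * sgb r * al * pair_sd r ^+ 2.
Definition pair_item r := if r then i2 else i1.
Definition pair_coord q l : J := (q.1, pair_item q.2, l).

(* [q.1] tells the two samples apart and [q.2] the two items of the pair;
   [be] tells whether the items are exchanged in the second sample and [e] is
   the sign of the perturbation of the means. *)
Definition coord_lik be l (w : Omega) : R :=
  2^-1 * \sum_e \prod_q
    (normal_pdf (pair_mean e (q.2 (+) (q.1 && be))) (pair_sd (q.2 (+) (q.1 && be)))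
       (crd (pair_coord q l) w) / phi01 (crd (pair_coord q l) w)).

Let S := s1 ^+ 2 + s2 ^+ 2.
(** [a] and [a'] are the variances of the differences [A] and [B] defined below, under the
    normalised geometric mean of the untilted densities without and with exchange. *)
Let a := al ^+ 2 * S.
Let tau := hmean_sd s1 s2.
Let a' := 2 * al ^+ 2 * tau ^+ 2.
Let be0 := bhatt s1 s2.

Lemma prod_bool2 (f : bool * bool -> R) :
  \prod_q f q = f (true, true) * f (true, false) * (f (false, true) * f (false, false)).
Proof.
transitivity (\prod_q f (q.1, q.2)); first by apply: eq_bigr => -[].
by rewrite -(pair_bigA _ (fun b r => f (b, r)))/= !big_bool.
Qed.

Lemma sum_bool2 (f : bool * bool -> R) :
  \sum_q f q = f (true, true) + f (true, false) + (f (false, true) + f (false, false)).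
Proof.
transitivity (\sum_q f (q.1, q.2)); first by apply: eq_bigr => -[].
by rewrite -(pair_bigA _ (fun b r => f (b, r)))/= !big_bool.
Qed.

Lemma prode_bool2 (f : bool * bool -> \bar R) :
  (\prod_q f q =
   f (true, true) * f (true, false) * (f (false, true) * f (false, false)))%E.
Proof.
transitivity (\prod_q f (q.1, q.2))%E; first by apply: eq_bigr => -[].
by rewrite -(pair_bigA _ (fun b r => f (b, r)))/= !big_bool.
Qed.

Let sd_neq0 r : pair_sd r != 0.
Proof. by rewrite /pair_sd; case: r; rewrite gt_eqF. Qed.

Let S_gt0 : 0 < S. Proof. by rewrite addr_gt0 ?exprn_gt0. Qed.

Let be0_gt0 : 0 < be0. Proof. by rewrite divr_gt0// !mulr_gt0. Qed.

Let tau_gt0 : 0 < tau.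
Proof. by rewrite sqrtr_gt0 divr_gt0// !mulr_gt0 ?exprn_gt0. Qed.

Let phi01_neq0 (x : R) : phi01 x != 0.
Proof. by rewrite gt_eqF ?normal_pdf_gt0. Qed.

Let A l w := al * (crd (pair_coord (false, false) l) w - m) -
             al * (crd (pair_coord (false, true) l) w - m).
Let B l w := al * (crd (pair_coord (true, false) l) w - m) -
             al * (crd (pair_coord (true, true) l) w - m).

(** Once the tilts are factored out, the sign [e] only multiplies a linear form in the exponent, and
    averaging over it gives a hyperbolic cosine. An exchange swaps the roles of the items in the
    second sample, hence the sign of [B]. The four normalising exponents add up to [- a]. *)
Let coord_likE be l w : coord_lik be l w =
  (\prod_q (normal_pdf m (pair_sd (q.2 (+) (q.1 && be))) (crd (pair_coord q l) w) /
       phi01 (crd (pair_coord q l) w))) *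
  (expR (- a) * ch (A l w + (if be then - B l w else B l w))).
Proof.
pose r' q := q.2 (+) (q.1 && be).
pose u e q := sgb e * sgb (r' q) * al * (crd (pair_coord q l) w - m).
pose v q := - (al ^+ 2 * pair_sd (r' q) ^+ 2 / 2).
have sgb2 e : sgb e ^+ 2 = 1 by rewrite /sgb sqrr_sign.
have regroup e : \prod_q (normal_pdf (pair_mean e (r' q)) (pair_sd (r' q))
      (crd (pair_coord q l) w) / phi01 (crd (pair_coord q l) w)) =
    (\prod_q (normal_pdf m (pair_sd (r' q)) (crd (pair_coord q l) w) /
      phi01 (crd (pair_coord q l) w))) * expR (\sum_q (u e q + v q)).
  rewrite expR_sum -big_split/=; apply: eq_bigr => q _.
  rewrite normal_pdf_tilt// !exprMn !sgb2 !mul1r expRD /u /v.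
  by field; exact: phi01_neq0.
have expo e : \sum_q (u e q + v q) =
    - a + sgb e * (A l w + (if be then - B l w else B l w)).
  rewrite sum_bool2 /u /v /r' /a /S /A /B /pair_sd /sgb.
  by case: (be) => /=; rewrite !(expr0, expr1); field.
rewrite /coord_lik -/r' /ch (eq_bigr _ (fun e _ => regroup e)) -mulr_sumr.
rewrite mulrCA; congr (_ * _); rewrite big_bool/= !expo.
rewrite !(expRD (- a)) /sgb expr0 expr1 mul1r mulN1r.
by move: (_ + if be then _ else _) => AB; field.
Qed.

(** Geometric mean of the untilted densities of one observation under the two hypotheses; these
    densities differ in the second sample only. *)
Definition geom_pdf q (x : R) : R :=
  if q.1 then Num.sqrt be0 * normal_pdf m tau x else normal_pdf m (pair_sd q.2) x.

Let geom_prod l w : R :=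
  \prod_q (geom_pdf q (crd (pair_coord q l) w) / phi01 (crd (pair_coord q l) w)).

Let geom_prod_ge0 l w : 0 <= geom_prod l w.
Proof.
apply: prodr_ge0 => q _; rewrite divr_ge0 ?normal_pdf_ge0// /geom_pdf.
by case: ifP; rewrite ?mulr_ge0 ?sqrtr_ge0 ?normal_pdf_ge0.
Qed.

Let sqrt_coord_lik l w :
  Num.sqrt (coord_lik false l w * coord_lik true l w) =
  geom_prod l w * expR (- a) *
  Num.sqrt (ch (A l w) ^+ 2 + ch (B l w) ^+ 2 - 1).
Proof.
rewrite !coord_likE -chDB.
set c0 := ch _; set c1 := ch _.
have K0 : 0 <= geom_prod l w * expR (- a) by rewrite mulr_ge0 ?expR_ge0.
rewrite -[X in _ = X * _](ger0_norm K0) -sqrtr_sqr -sqrtrM ?sqr_ge0//; congr Num.sqrt.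
rewrite /geom_prod !prod_bool2 /geom_pdf /=.
move: (normal_pdf_gmean m (crd (pair_coord (true, true) l) w) s1_gt0 s2_gt0).
move: (normal_pdf_gmean m (crd (pair_coord (true, false) l) w) s1_gt0 s2_gt0).
rewrite -/be0 -/tau => h1 h2.
have -> : forall x x' y y' e : R, (x * x' * (y * y') * e) ^+ 2 =
  x ^+ 2 * x' ^+ 2 * (y * y') ^+ 2 * e ^+ 2 by move=> *; ring.
rewrite !expr_div_n -h1 -h2; field.
by rewrite !phi01_neq0.
Qed.

Definition pair_coords l : {set J} :=
  [set j | (j.2 == l) && ((j.1.2 == i1) || (j.1.2 == i2))]%SET.

Let pair_coordP q l : pair_coord q l \in pair_coords l.
Proof. by rewrite inE /= /pair_item eqxx; case: q.2; rewrite eqxx ?orbT. Qed.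

Let pair_coord_inj l : injective (pair_coord ^~ l).
Proof.
move=> [b r] [b' r'] [-> ]; rewrite /pair_item.
by case: r; case: r' => // /eqP; rewrite ?(negbTE i12)// eq_sym (negbTE i12).
Qed.

Let measurable_coord_ratio (f : R -> R) (V : {set J}) j : measurable_fun setT f ->
  j \in V -> measurable_fun setT
    ((fun w => f (crd j w) / phi01 (crd j w)) : cylType crd V -> R).
Proof.
move=> mf jV; apply: (measurableT_comp (f := fun x => f x / phi01 x)).
  by apply: measurable_funM => //; exact: measurable_normal_pdf_inv.
exact: cylinder_coord.
Qed.

Let integral_pair_prod (h : bool * bool -> R -> R) l :
  (forall q, measurable_fun setT (h q)) -> (forall q x, 0 <= h q x) ->
  (\int[P]_w (\prod_q (h q (crd (pair_coord q l) w) /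
                 phi01 (crd (pair_coord q l) w)))%:E =
   \prod_q \int[lebesgue_measure]_x (h q x)%:E)%E.
Proof.
move=> mh h0.
rewrite (integral_indep_prod (measurable_coord iid) (coord_indep iid)
  (S := fun q => [set pair_coord q l]%SET)
  (F := fun q w => h q (crd (pair_coord q l) w) / phi01 (crd (pair_coord q l) w))).
- by apply: eq_bigr => q _; rewrite integral_coord.
- move=> q q' qq'; rewrite disjoints1 inE; apply: contra qq' => /eqP.
  by move=> /pair_coord_inj ->.
- by move=> q; apply: measurable_coord_ratio => //; rewrite inE.
by move=> q w; rewrite divr_ge0 ?normal_pdf_ge0.
Qed.

Lemma measurable_coord_lik be l :
  measurable_fun setT (coord_lik be l : cylType crd (pair_coords l) -> R).
Proof.
apply: measurable_funM => //; apply: measurable_sum => e.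
apply: measurable_prod => q _; apply: measurable_coord_ratio => //.
exact: measurable_normal_pdf.
Qed.

Lemma coord_lik_ge0 be l w : 0 <= coord_lik be l w.
Proof.
rewrite mulr_ge0//; apply: sumr_ge0 => e _; apply: prodr_ge0 => q _.
by rewrite divr_ge0 ?normal_pdf_ge0.
Qed.

Lemma integral_coord_lik be l : (\int[P]_w (coord_lik be l w)%:E = 1)%E.
Proof.
have mprod e : measurable_fun setT (fun w => \prod_q
    (normal_pdf (pair_mean e (q.2 (+) (q.1 && be))) (pair_sd (q.2 (+) (q.1 && be)))
       (crd (pair_coord q l) w) / phi01 (crd (pair_coord q l) w))).
  apply: measurable_prod => q _; exact: (measurable_ratio iid).
under eq_integral do rewrite /coord_lik EFinM -sumEFin.
rewrite ge0_integralZl//; last 2 first.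
- by apply: emeasurable_sum => e; exact/measurable_EFinP.
- move=> w _; apply: sume_ge0 => e _; rewrite lee_fin; apply: prodr_ge0 => q _.
  by rewrite divr_ge0 ?normal_pdf_ge0.
rewrite ge0_integral_sum//; last 2 first.
- by move=> e; exact/measurable_EFinP.
- move=> e w _; rewrite lee_fin; apply: prodr_ge0 => q _.
  by rewrite divr_ge0 ?normal_pdf_ge0.
rewrite (eq_bigr (fun=> 1%E)) => [|e _].
  by rewrite big_bool/= -EFinD -EFinM mulVf.
rewrite (integral_pair_prod (h := fun q => normal_pdf
    (pair_mean e (q.2 (+) (q.1 && be))) (pair_sd (q.2 (+) (q.1 && be))))).
- by rewrite big1// => q _; rewrite integral_normal_pdf.
- by move=> q; exact: measurable_normal_pdf.
by move=> q x; rewrite normal_pdf_ge0.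
Qed.

Let measurable_geom q : measurable_fun setT (geom_pdf q).
Proof.
rewrite /geom_pdf; case: q.1; last exact: measurable_normal_pdf.
by apply: measurable_funM => //; exact: measurable_normal_pdf.
Qed.

Let geom_ge0 q x : 0 <= geom_pdf q x.
Proof.
by rewrite /geom_pdf; case: ifP; rewrite ?mulr_ge0 ?sqrtr_ge0 ?normal_pdf_ge0.
Qed.

Let measurable_expR_affine (t : R) :
  measurable_fun setT (fun x : R => expR (t * (x - m))).
Proof.
by apply: measurableT_comp => //; apply: measurable_funM => //; exact: measurable_funB.
Qed.

Let integral_geom q t :
  (\int[lebesgue_measure]_x (geom_pdf q x * expR (t * (x - m)))%:E =
   (if q.1 then Num.sqrt be0 * expR (t ^+ 2 * tau ^+ 2 / 2)
    else expR (t ^+ 2 * pair_sd q.2 ^+ 2 / 2))%:E)%E.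
Proof.
rewrite /geom_pdf; case: q.1; last by rewrite integral_normal_pdf_tilt.
under eq_integral do rewrite -mulrA EFinM.
rewrite ge0_integralZl//; last 2 first.
- apply/measurable_EFinP.
  exact: (measurable_funM (measurable_normal_pdf m tau) (measurable_expR_affine t)).
- by move=> x _; rewrite lee_fin mulr_ge0 ?normal_pdf_ge0 ?expR_ge0.
by rewrite integral_normal_pdf_tilt ?gt_eqF.
Qed.

(** The four observations are independent under the weight [geom_prod], so the integral is a product
    of Gaussian moment generating functions. *)
Let integral_geom_exp (p u : R) l :
  (\int[P]_w (geom_prod l w * expR (p * A l w + u * B l w))%:E =
   (be0 * expR ((p ^+ 2 * a + u ^+ 2 * a') / 2))%:E)%E.
Proof.
pose t q := (if q.1 then u else p) * sgb q.2 * al.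
under eq_integral => w _.
  rewrite (_ : _ * _ = \prod_q ((geom_pdf q (crd (pair_coord q l) w) *
      expR (t q * (crd (pair_coord q l) w - m))) / phi01 (crd (pair_coord q l) w))).
    over.
  rewrite (_ : p * _ + _ = \sum_q (t q * (crd (pair_coord q l) w - m))).
    rewrite expR_sum -big_split/=; apply: eq_bigr => q _.
    by field; exact: phi01_neq0.
  by rewrite sum_bool2 /t /A /B /sgb /= !(expr0, expr1); ring.
rewrite (integral_pair_prod (h := fun q x => geom_pdf q x * expR (t q * (x - m)))).
- under eq_bigr do rewrite integral_geom.
  rewrite prode_bool2/= -!EFinM; congr EFin.
  rewrite [LHS](_ : _ = (Num.sqrt be0 ^+ 2) * (
     expR (t (true, true) ^+ 2 * tau ^+ 2 / 2) *
     expR (t (true, false) ^+ 2 * tau ^+ 2 / 2) *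
     expR (t (false, true) ^+ 2 * s2 ^+ 2 / 2) *
     expR (t (false, false) ^+ 2 * s1 ^+ 2 / 2))); last by rewrite /pair_sd; ring.
  rewrite sqr_sqrtr ?ltW// -!expRD; congr (_ * expR _).
  by rewrite /t /sgb /= !(expr0, expr1) /a /a' /S; field.
- by move=> q; apply: measurable_funM.
by move=> q x; rewrite mulr_ge0 ?expR_ge0.
Qed.

(** Combinations of exponentials in [A] and [B], coded by a list of coefficients with their two
    slopes. The polynomial bounds in cosines all have this form, and so one integral formula serves
    them all. *)
Let comb (s : seq (R * (R * R))) l w : R :=
  \sum_(z <- s) z.1 * expR (z.2.1 * A l w + z.2.2 * B l w).

Let measurable_AB l : measurable_fun setT (A l) * measurable_fun setT (B l).
Proof.
by split; apply: measurable_funB; apply: measurable_funM => //;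
  apply: measurable_funB => //; exact: (measurable_coord iid).
Qed.

Let measurable_geom_prod l : measurable_fun setT (geom_prod l).
Proof.
apply: measurable_prod => q _.
apply: (measurableT_comp (f := fun x => geom_pdf q x / phi01 x)).
  by apply: measurable_funM => //; exact: measurable_normal_pdf_inv.
exact: (measurable_coord iid).
Qed.

Let measurable_geom_exp p u l :
  measurable_fun setT (fun w => geom_prod l w * expR (p * A l w + u * B l w)).
Proof.
have [mA mB] := measurable_AB l.
apply: measurable_funM => //; apply: measurableT_comp => //.
by apply: measurable_funD; apply: measurable_funM.
Qed.

Let measurable_comb s l : measurable_fun setT (fun w => geom_prod l w * comb s l w).
Proof.
rewrite (_ : (fun _ => _) = fun w => \sum_(z <- s)
    z.1 * (geom_prod l w * expR (z.2.1 * A l w + z.2.2 * B l w))).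
  by apply: measurable_sum => z; exact: measurable_funM.
by apply/funext => w; rewrite mulr_sumr; apply: eq_bigr => z _; rewrite mulrCA.
Qed.

Let integral_comb s l : (forall z, z \in s -> 0 <= z.1) ->
  (\int[P]_w (geom_prod l w * comb s l w)%:E =
   (be0 * \sum_(z <- s) z.1 * expR ((z.2.1 ^+ 2 * a + z.2.2 ^+ 2 * a') / 2))%:E)%E.
Proof.
elim: s => [_|z s IH z0].
  rewrite big_nil mulr0; under eq_integral do rewrite /comb big_nil mulr0.
  by rewrite integral0.
have comb0 w : 0 <= comb s l w.
  rewrite /comb big_seq; apply: sumr_ge0 => y ys.
  by rewrite mulr_ge0 ?expR_ge0 ?z0// inE ys orbT.
have z10 : 0 <= z.1 by rewrite z0 ?mem_head.
under eq_integral do rewrite /comb big_cons mulrDr mulrCA EFinD.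
rewrite ge0_integralD//; last 4 first.
- by move=> w _; rewrite lee_fin !mulr_ge0 ?expR_ge0.
- apply/measurable_EFinP; apply: measurable_funM; first exact: measurable_cst.
  exact: measurable_geom_exp.
- by move=> w _; rewrite lee_fin; apply: mulr_ge0 => //; exact: comb0.
- by apply/measurable_EFinP; exact: (measurable_comb s l).
under eq_integral do rewrite EFinM.
rewrite ge0_integralZl//; last 2 first.
- by apply/measurable_EFinP; exact: measurable_geom_exp.
- by move=> w _; rewrite lee_fin mulr_ge0 ?expR_ge0.
rewrite integral_geom_exp IH => [|y ys]; last by rewrite z0 ?inE ?ys ?orbT.
by rewrite -EFinM -EFinD big_cons mulrDr mulrCA.
Qed.

Let measurable_sqrt_lik l :
  measurable_fun setT (fun w => Num.sqrt (coord_lik false l w * coord_lik true l w)).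
Proof.
apply: measurableT_comp.
  by apply: continuous_measurable_fun; exact: sqrt_continuous.
by apply: measurable_funM; apply: (cylType_measurable (measurable_coord iid));
  exact: measurable_coord_lik.
Qed.

Lemma affinity_ge_exp l : ((be0 * expR (- a / 2))%:E <=
  \int[P]_w (Num.sqrt (coord_lik false l w * coord_lik true l w))%:E)%E.
Proof.
(* The list codes [expR (- a) * ch (A l w)], the integrand left by [sqrt_ge_left]. *)
pose s : seq (R * (R * R)) :=
  [:: (expR (- a) / 2, (1, 0)); (expR (- a) / 2, (-1, 0))].
have := @integral_comb s l; rewrite /s => /(_ _)/wrap[].
  by move=> z; rewrite !inE => /orP[] /eqP -> /=; rewrite divr_ge0 ?expR_ge0.
rewrite !big_cons big_nil /= addr0 => sE.
rewrite [X in (X%:E <= _)%E](_ : _ = be0 *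
    (expR (- a) / 2 * expR ((1 ^+ 2 * a + 0 ^+ 2 * a') / 2) +
     expR (- a) / 2 * expR (((-1) ^+ 2 * a + 0 ^+ 2 * a') / 2))); last first.
  rewrite sqrrN expr1n expr0n /= mul1r mul0r addr0 -mulrDl -splitr -expRD.
  by congr (_ * expR _); field.
rewrite -sE; apply: ge0_le_integral => //.
- move=> w _; rewrite lee_fin mulr_ge0// /comb !big_cons big_nil.
  by rewrite !addr_ge0 ?mulr_ge0 ?expR_ge0.
- by apply/measurable_EFinP; exact: measurable_comb.
- by apply/measurable_EFinP; exact: measurable_sqrt_lik.
move=> w _; rewrite lee_fin sqrt_coord_lik -mulrA ler_wpM2l//.
rewrite /comb !big_cons big_nil /= addr0 !mul0r !addr0 mul1r mulN1r -mulrDr -mulrA.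
by rewrite ler_wpM2l ?expR_ge0// mulrC sqrt_ge_left ?ch_ge1// (le_trans _ (ch_ge1 _)).
Qed.

Lemma affinity_ge_gap l :
  ((be0 * (expR (- a) * (2 * expR (a / 2) + 2 * expR (a' / 2)
      - expR (a / 2) * expR (a' / 2) - 2)))%:E <=
  \int[P]_w (Num.sqrt (coord_lik false l w * coord_lik true l w))%:E)%E.
Proof.
pose E := expR (- a); have E0 : 0 <= E by rewrite expR_ge0.
(* [s] codes the positive part and [t] the negative part of 2X + 2Y - XY - 2, both scaled by [E]. *)
pose s : seq (R * (R * R)) :=
  [:: (E, (1, 0)); (E, (-1, 0)); (E, (0, 1)); (E, (0, -1))].
pose t : seq (R * (R * R)) :=
  [:: (E / 4, (1, 1)); (E / 4, (1, -1)); (E / 4, (-1, 1)); (E / 4, (-1, -1));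
      (E * 2, (0, 0))].
have s0 z : z \in s -> 0 <= z.1.
  by rewrite !inE => /or4P[] /eqP -> /=.
have t0 z : z \in t -> 0 <= z.1.
  rewrite !inE => /or4P[/eqP->|/eqP->|/eqP->|/orP[/eqP->|/eqP->]] /=;
    by rewrite ?divr_ge0 ?mulr_ge0.
have combs w : comb s l w = E * (2 * ch (A l w) + 2 * ch (B l w)).
  rewrite /comb !big_cons big_nil /= /ch.
  by rewrite !mul0r !mul1r !mulN1r !addr0 !add0r; field.
have combt w : comb t l w = E * (ch (A l w) * ch (B l w) + 2).
  rewrite /comb !big_cons big_nil /= /ch.
  by rewrite !mul0r !mul1r !mulN1r !addr0 !expRD expR0; field.
have ints := @integral_comb s l s0; have intt := @integral_comb t l t0.
set K := (be0 * _) in intt.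
set L := (be0 * _); set I := (\int[P]_w _)%E.
(* Adding the integral of the negative part to both sides leaves only nonnegative integrands to
   compare. *)
suff: ((L + K)%:E <= I + K%:E)%E by rewrite EFinD leeD2rE.
rewrite -[X in (_ <= _ + X)%E]intt /K /L /I.
rewrite [X in (X%:E <= _)%E](_ : _ = be0 *
    (\sum_(z <- s) z.1 * expR ((z.2.1 ^+ 2 * a + z.2.2 ^+ 2 * a') / 2))); last first.
  rewrite /s /t !big_cons !big_nil /= !sqrrN !expr1n !expr0n /= !mul0r !mul1r.
  by rewrite !addr0 !add0r mul0r expR0 !mulrDl !expRD -/E; field.
rewrite -ints -ge0_integralD//; last 3 first.
- by apply/measurable_EFinP; exact: measurable_sqrt_lik.
- move=> w _; rewrite lee_fin combt !mulr_ge0 ?addr_ge0 ?mulr_ge0//;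
    by rewrite (le_trans _ (ch_ge1 _)).
- by apply/measurable_EFinP; exact: measurable_comb.
apply: ge0_le_integral => //.
- move=> w _; rewrite lee_fin combs !mulr_ge0 ?addr_ge0 ?mulr_ge0//;
    by rewrite (le_trans _ (ch_ge1 _)).
- by apply/measurable_EFinP; exact: measurable_comb.
- apply/measurable_EFinP; apply: measurable_funD; first exact: measurable_sqrt_lik.
  exact: measurable_comb.
move=> w _; rewrite -EFinD lee_fin sqrt_coord_lik combs combt -mulrA -[leRHS]mulrDr.
by rewrite ler_wpM2l// -[leRHS]mulrDr ler_wpM2l// sqrt_ge_prod_gap ?ch_ge1.
Qed.

End matched_pair.

(** * From the affinity of two densities to the integral of their maximum *)

Section affinity.
Context dT (T : measurableType dT) (R : realType) (mu : {measure set T -> \bar R}).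
Implicit Types f g : T -> R.

(** When x is the larger, the difference of the sides is (sqrt y - t sqrt x)^2 + t^2 y. The bound is
    linear in the maximum, the root and the sum, and can be integrated term by term. *)
Lemma sqrt_max_gap (x y t : R) : 0 <= x -> 0 <= y -> 0 <= t ->
  Num.max x y + 2 * t * Num.sqrt (x * y) <= (1 + t ^+ 2) * (x + y).
Proof.
move=> x0 y0 t0; wlog xy : x y x0 y0 / y <= x => [hw|].
  have [yx|xy] := orP (le_total y x); first exact: hw.
  by rewrite maxC [x * y]mulrC [x + y]addrC; exact: hw.
rewrite max_l// sqrtrM//.
have := sqr_sqrtr x0; have := sqr_sqrtr y0.
move: (Num.sqrt x) (Num.sqrt y) (sqrtr_ge0 x) (sqrtr_ge0 y) => u v u0 v0 <- <-.
rewrite -subr_ge0 [X in 0 <= X](_ : _ = (v - t * u) ^+ 2 + t ^+ 2 * v ^+ 2).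
  by rewrite addr_ge0 ?sqr_ge0// mulr_ge0 ?sqr_ge0.
by ring.
Qed.

Lemma measurable_sqrtM f g : measurable_fun setT f -> measurable_fun setT g ->
  measurable_fun setT (fun w => Num.sqrt (f w * g w)).
Proof.
move=> mf mg; apply: measurableT_comp.
  by apply: continuous_measurable_fun; exact: sqrt_continuous.
exact: measurable_funM.
Qed.

(** The pointwise bound is integrated with t = rho / 2: its right side becomes 2 + rho^2 / 2, and
    the affinity term on the left is at least rho^2. *)
Lemma integral_max_le f g (rho : R) :
  measurable_fun setT f -> measurable_fun setT g ->
  (forall w, 0 <= f w) -> (forall w, 0 <= g w) ->
  (\int[mu]_w (f w)%:E = 1)%E -> (\int[mu]_w (g w)%:E = 1)%E ->
  0 <= rho -> (rho%:E <= \int[mu]_w (Num.sqrt (f w * g w))%:E)%E ->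
  (\int[mu]_w (Num.max (f w) (g w))%:E <= (2 - rho ^+ 2 / 2)%:E)%E.
Proof.
move=> mf mg f0 g0 f1 g1 rho0 rhoE.
have msq := measurable_sqrtM mf mg.
have mmax : measurable_fun setT (fun w => Num.max (f w) (g w)).
  exact: measurable_maxr.
have max0 w : 0 <= Num.max (f w) (g w) by rewrite le_max f0.
have t0 : 0 <= rho by [].
suff: (\int[mu]_w (Num.max (f w) (g w))%:E + (rho ^+ 2)%:E <=
    (2 + rho ^+ 2 / 2)%:E)%E.
  move=> h; have <- : 2 + rho ^+ 2 / 2 - rho ^+ 2 = 2 - rho ^+ 2 / 2 by field.
  by rewrite EFinB leeBrDr.
apply: (@le_trans _ _ (\int[mu]_w (Num.max (f w) (g w))%:E +
   rho%:E * \int[mu]_w (Num.sqrt (f w * g w))%:E)%E).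
  by rewrite leeD2l// expr2 EFinM lee_wpmul2l// lee_fin.
rewrite -ge0_integralZl//; last exact/measurable_EFinP.
rewrite -ge0_integralD//; last 4 first.
- by move=> w _; rewrite lee_fin.
- exact/measurable_EFinP.
- by move=> w _; rewrite -EFinM lee_fin mulr_ge0 ?sqrtr_ge0.
- by apply/measurable_EFinP/measurable_funM.
apply: (@le_trans _ _
    (\int[mu]_w ((1 + (rho / 2) ^+ 2)%:E * ((f w)%:E + (g w)%:E)))%E).
  apply: ge0_le_integral => //.
  - by move=> w _; rewrite -EFinM -EFinD lee_fin addr_ge0 ?mulr_ge0 ?sqrtr_ge0.
  - apply/measurable_EFinP; apply: measurable_funD => //.
    exact: measurable_funM.
  - by apply/measurable_EFinP/measurable_funM => //; exact: measurable_funD.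
  move=> w _; rewrite -EFinM -!EFinD -EFinM lee_fin.
  have := @sqrt_max_gap (f w) (g w) (rho / 2) (f0 w) (g0 w).
  have -> : 2 * (rho / 2) = rho by field.
  by apply; rewrite divr_ge0.
rewrite ge0_integralZl//; last 3 first.
- by apply/measurable_EFinP/measurable_funD.
- by move=> w _; rewrite -EFinD lee_fin addr_ge0.
- by rewrite lee_fin addr_ge0 ?sqr_ge0.
rewrite ge0_integralD//; last 4 first.
- by move=> w _; rewrite lee_fin.
- exact/measurable_EFinP.
- by move=> w _; rewrite lee_fin.
- exact/measurable_EFinP.
rewrite f1 g1 -EFinD -EFinM lee_fin le_eqVlt; apply/orP; left; apply/eqP.
by field.
Qed.

End affinity.

Section pair_likelihood.
Context dO (Omega : measurableType dO) (R : realType) (P : probability Omega R).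
Context (n d : nat) (noise : bool -> 'I_n -> 'I_d -> Omega -> R).
Hypothesis iid : iid_std_normal P noise.
Context (i1 i2 : 'I_n) (s1 s2 m al : R).
Hypotheses (i12 : i1 != i2) (s1_gt0 : 0 < s1) (s2_gt0 : 0 < s2).
Implicit Types (be : bool) (l : 'I_d).
Local Notation J := (bool * 'I_n * 'I_d)%type.
Local Notation clik := (coord_lik noise i1 i2 s1 s2 m al).

Definition pair_lik be (w : Omega) : R := \prod_l clik be l w.

Definition pair_set : {set J} := [set j | (j.1.2 == i1) || (j.1.2 == i2)]%SET.

Lemma measurable_pair_lik be :
  measurable_fun setT (pair_lik be : cylType (coord noise) pair_set -> R).
Proof.
apply: measurable_prod => l _; apply: (cylType_sub (S := pair_coords i1 i2 l)).
  by apply/fintype.subsetP => j; rewrite !inE => /andP[].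
exact: measurable_coord_lik.
Qed.

Lemma pair_lik_ge0 be w : 0 <= pair_lik be w.
Proof. by apply: prodr_ge0 => l _; exact: coord_lik_ge0. Qed.

Let disj l l' : l != l' ->
  [disjoint pair_coords i1 i2 l & pair_coords i1 i2 l']%B.
Proof.
move=> ll'; rewrite disjoint_subset; apply/fintype.subsetP => j.
by rewrite !inE => /andP[/eqP -> _]; rewrite (negbTE ll').
Qed.

Lemma integral_pair_lik be : (\int[P]_w (pair_lik be w)%:E = 1)%E.
Proof.
rewrite (integral_indep_prod (measurable_coord iid) (coord_indep iid)
  (S := pair_coords i1 i2) (F := fun l => clik be l))//.
- by rewrite big1// => l _; exact: integral_coord_lik.
- by move=> l; exact: measurable_coord_lik.
by move=> l w; exact: coord_lik_ge0.
Qed.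

(** The coordinates are independent and the root of a product factors over them, so affinities
    multiply. *)
Lemma pair_affinity (rho : R) : 0 <= rho ->
  (forall l, rho%:E <= \int[P]_w (Num.sqrt (clik false l w * clik true l w))%:E)%E ->
  ((rho ^+ d)%:E <= \int[P]_w (Num.sqrt (pair_lik false w * pair_lik true w))%:E)%E.
Proof.
move=> rho0 rhoE; under eq_integral => w _.
  rewrite (_ : Num.sqrt _ = \prod_l Num.sqrt (clik false l w * clik true l w)).
    over.
  rewrite /pair_lik -big_split/=.
  elim/big_rec2: _ => [|l x y _ <-]; first by rewrite sqrtr1.
  by rewrite sqrtrM// mulr_ge0 ?coord_lik_ge0.
rewrite (integral_indep_prod (measurable_coord iid) (coord_indep iid)
  (S := pair_coords i1 i2)
  (F := fun l w => Num.sqrt (clik false l w * clik true l w)))//.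
- rewrite -[d in rho ^+ d]card_ord -prodr_const -prodEFin.
  have h : forall s : seq 'I_d, (0 <= \prod_(l <- s) rho%:E)%E /\
    (\prod_(l <- s) rho%:E <= \prod_(l <- s)
      \int[P]_w (Num.sqrt (clik false l w * clik true l w))%:E)%E.
    elim=> [|l s [h0 h]]; first by rewrite !big_nil.
    rewrite !big_cons; split; first by rewrite mule_ge0.
    by apply: lee_pmul.
  by have [] := h (index_enum 'I_d).
by move=> l; apply: measurable_sqrtM; exact: measurable_coord_lik.
Qed.

Lemma integral_pair_max (rho : R) : 0 <= rho ->
  (rho%:E <= \int[P]_w (Num.sqrt (pair_lik false w * pair_lik true w))%:E)%E ->
  (\int[P]_w (Num.max (pair_lik false w) (pair_lik true w))%:E <=
   (2 - rho ^+ 2 / 2)%:E)%E.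
Proof.
move=> rho0 rhoE.
have mp be : measurable_fun setT (pair_lik be).
  by apply: (cylType_measurable (measurable_coord iid)); exact: measurable_pair_lik.
by apply: integral_max_le => //; [exact: pair_lik_ge0|exact: pair_lik_ge0|
  exact: integral_pair_lik|exact: integral_pair_lik].
Qed.

End pair_likelihood.

(** * Numerical bounds on the affinity, with [L] for log n and [D] for the dimension *)

Section affinity_bound.
Context (R : realType) (L D al s1 s2 : R).
Hypotheses (L0 : 0 <= L) (D0 : 0 < D) (s10 : 0 < s1) (s20 : 0 < s2).
Hypothesis close : (s1 ^+ 2 - s2 ^+ 2) ^+ 2 * (16 * D) <= L * (s1 ^+ 2 * s2 ^+ 2).

Let S := s1 ^+ 2 + s2 ^+ 2.
Let p := s1 ^+ 2 * s2 ^+ 2.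
Let a := al ^+ 2 * S.
Let a' := 2 * al ^+ 2 * hmean_sd s1 s2 ^+ 2.

Let S0 : 0 < S. Proof. by rewrite addr_gt0 ?exprn_gt0. Qed.
Let p0 : 0 < p. Proof. by rewrite mulr_gt0 ?exprn_gt0. Qed.

Let rel_gap : (s1 ^+ 2 - s2 ^+ 2) ^+ 2 / (4 * p) <= L / (64 * D).
Proof.
rewrite ler_pdivrMr ?mulr_gt0// mulrAC ler_pdivlMr ?mulr_gt0//.
by move: close; rewrite -/p; lra.
Qed.

(** The inverse square of [bhatt] is 1 plus the relative gap of the variances, hence at most the
    exponential of that gap. *)
Let bhatt_ge : expR (- (L / (128 * D))) <= bhatt s1 s2.
Proof.
have b0 : 0 < bhatt s1 s2 by rewrite divr_gt0 ?mulr_gt0.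
rewrite -(@ler_pXn2r _ 2)// ?nnegrE ?expR_ge0 ?(ltW b0)//.
have -> : bhatt s1 s2 ^+ 2 = (S ^+ 2 / (4 * p))^-1.
  by rewrite /bhatt -/S /p; field; rewrite !gt_eqF.
have -> : S ^+ 2 / (4 * p) = 1 + (s1 ^+ 2 - s2 ^+ 2) ^+ 2 / (4 * p).
  by rewrite /S /p; field; rewrite !gt_eqF.
rewrite -expRM_natl mulrN expRN lef_pV2 ?posrE ?expR_gt0//; last first.
  by rewrite ltr_pwDl// divr_ge0 ?sqr_ge0// mulr_ge0// ltW.
apply: le_trans (expR_ge1Dx _); rewrite lerD2l.
rewrite (_ : 2 * (L / (128 * D)) = L / (64 * D)); last by field; rewrite gt_eqF.
exact: rel_gap.
Qed.

Let a_ge0 : 0 <= a. Proof. by rewrite mulr_ge0 ?sqr_ge0 ?(ltW S0). Qed.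

Let a'E : a' = a - a * ((s1 ^+ 2 - s2 ^+ 2) ^+ 2 / S ^+ 2).
Proof.
have h : 0 <= 2 * s1 ^+ 2 * s2 ^+ 2 / (s1 ^+ 2 + s2 ^+ 2).
  by apply: ltW; rewrite divr_gt0// !mulr_gt0 ?exprn_gt0.
rewrite /a' /a sqr_sqrtr//.
by rewrite /S; field; rewrite gt_eqF//; exact: S0.
Qed.

Let a'_ge0 : 0 <= a'. Proof. by rewrite mulr_ge0 ?sqr_ge0// mulr_ge0 ?sqr_ge0. Qed.

Let gap_a : a - a' <= a * (L / (64 * D)).
Proof.
rewrite a'E opprB addrC subrK ler_wpM2l//.
apply: le_trans rel_gap; rewrite ler_wpM2l ?sqr_ge0//.
rewrite lef_pV2 ?posrE ?exprn_gt0 ?mulr_gt0//.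
rewrite -subr_ge0 [X in 0 <= X](_ : _ = (s1 ^+ 2 - s2 ^+ 2) ^+ 2) ?sqr_ge0//.
by rewrite /S /p; ring.
Qed.

Let a'_le : a' <= a.
Proof. by rewrite a'E gerBl mulr_ge0 ?divr_ge0 ?sqr_ge0. Qed.

(** An exponent L/(2D) per coordinate is what makes the squared affinity over all coordinates 1/n.
    Here the unequal variances and the separation each cost at most L/(128D). *)
Lemma exp_le_affinity_low : a <= L / (64 * D) ->
  expR (- (L / (2 * D))) <= bhatt s1 s2 * expR (- a / 2).
Proof.
move=> aL; apply: (@le_trans _ _ (expR (- (L / (128 * D))) * expR (- a / 2))); last first.
  by rewrite ler_wpM2r ?expR_ge0.
rewrite -expRD ler_expR.
have -> : L / (2 * D) = L / (64 * D) * 32 by field; rewrite gt_eqF.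
have -> : L / (128 * D) = L / (64 * D) / 2 by field; rewrite gt_eqF.
by move: aL a_ge0; lra.
Qed.

Let one_sub_expRN (z : R) : 1 - expR (- z) <= z.
Proof. by have := expR_ge1Dx (- z); lra. Qed.

(** The exponent L/(2D) covers L/(128D) from [bhatt], (a - a')/2 <= L/(128D), and a^2 <= L/(4096D).
    The separation enters through a^2 only, which is how the fourth power of kappa arises. *)
Lemma exp_le_affinity_gap : a ^+ 2 <= L / (4096 * D) -> L <= D ->
  expR (- (L / (2 * D))) <= bhatt s1 s2 * (expR (- a) *
    (2 * expR (a / 2) + 2 * expR (a' / 2) - expR (a / 2) * expR (a' / 2) - 2)).
Proof.
move=> a2L LD.
have LD1 : L / D <= 1 by rewrite ler_pdivrMr// mul1r.
have LDge0 : 0 <= L / D by rewrite divr_ge0 ?(ltW D0).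
have a2 : a ^+ 2 <= 1.
  apply: le_trans a2L _; rewrite (_ : L / (4096 * D) = L / D / 4096); first by lra.
  by field; rewrite gt_eqF.
have a1 : a <= 1 by rewrite -(@ler_pXn2r _ 2)// ?nnegrE// expr1n.
have gap : expR ((a' - a) / 2) * (1 - a ^+ 2 / 2) <= expR (- a) *
    (2 * expR (a / 2) + 2 * expR (a' / 2) - expR (a / 2) * expR (a' / 2) - 2).
  (* With [expR ((a' - a) / 2)] factored out, the loss is a product of two terms of order [a]: no
     first-order term remains. *)
  have -> : expR (- a) * (2 * expR (a / 2) + 2 * expR (a' / 2)
       - expR (a / 2) * expR (a' / 2) - 2) = expR ((a' - a) / 2) *
      (1 - 2 * ((1 - expR (- (a / 2))) * (1 - expR (- (a' / 2))))).
    have -> : expR (- a) = (expR (a / 2))^-1 ^+ 2.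
      by rewrite -expRN -expRM_natl; congr expR; field.
    have -> : expR ((a' - a) / 2) = expR (a' / 2) * (expR (a / 2))^-1.
      by rewrite -expRN -expRD; congr expR; field.
    by rewrite !expRN; field; rewrite !gt_eqF ?expR_gt0.
  rewrite ler_wpM2l ?expR_ge0// lerD2l lerN2.
  have -> : a ^+ 2 / 2 = 2 * (a / 2 * (a / 2)) by field.
  rewrite ler_wpM2l//; apply: ler_pM => //.
  - by rewrite subr_ge0 expR_le1; move: a_ge0; lra.
  - by rewrite subr_ge0 expR_le1; move: a'_ge0; lra.
  by apply: le_trans (one_sub_expRN _) _; rewrite ler_pM2r// invr_gt0.
(* With z = a^2 in [0, 1]: exp(-z) <= 1/(1 + z) <= 1 - z/2. *)
have quad : expR (- a ^+ 2) <= 1 - a ^+ 2 / 2.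
  rewrite expRN; apply: (@le_trans _ _ (1 + a ^+ 2)^-1).
    rewrite lef_pV2 ?posrE ?expR_gt0 ?expR_ge1Dx//.
    by rewrite ltr_pwDl// sqr_ge0.
  have z0 : 0 <= a ^+ 2 by exact: sqr_ge0.
  rewrite -div1r ler_pdivrMr; last by rewrite ltr_pwDl.
  by move: (a ^+ 2) z0 a2 => z z0 z1; nra.
apply: (@le_trans _ _ (expR (- (L / (128 * D))) *
   (expR ((a' - a) / 2) * expR (- a ^+ 2)))).
  rewrite -!expRD ler_expR.
  have g : a - a' <= L / (64 * D).
    apply: le_trans gap_a _; rewrite ler_piMl// divr_ge0// mulr_ge0//.
    exact: ltW.
  move: g a2L; have -> : L / (2 * D) = L / D / 2 by field; rewrite gt_eqF.
  have -> : L / (128 * D) = L / D / 128 by field; rewrite gt_eqF.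
  have -> : L / (64 * D) = L / D / 64 by field; rewrite gt_eqF.
  have -> : L / (4096 * D) = L / D / 4096 by field; rewrite gt_eqF.
  by lra.
apply: ler_pM => //; rewrite ?mulr_ge0 ?expR_ge0//.
apply: le_trans gap; by rewrite ler_wpM2l ?expR_ge0.
Qed.

End affinity_bound.

(** * The Bayes risk of the random exchanges *)

Section swaps.
Context (n M : nat) (it : 'I_M * bool -> 'I_n).
Hypothesis it_inj : injective it.
Implicit Types b : {ffun 'I_M -> bool}.

Definition dec (i : 'I_n) : option ('I_M * bool) := [pick kr | it kr == i].

Lemma decK kr : dec (it kr) = Some kr.
Proof.
rewrite /dec; case: pickP => [kr' /eqP /it_inj -> //|/(_ kr)].
by rewrite eqxx.
Qed.

Lemma dec_some i kr : dec i = Some kr -> it kr = i.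
Proof. by rewrite /dec; case: pickP => // kr' /eqP <- [->]. Qed.

Definition swap_fun b (i : 'I_n) : 'I_n :=
  if dec i is Some (k, r) then it (k, r (+) b k) else i.

Lemma swap_fun_it b k r : swap_fun b (it (k, r)) = it (k, r (+) b k).
Proof. by rewrite /swap_fun decK. Qed.

Lemma swap_funK b : involutive (swap_fun b).
Proof.
move=> i; rewrite {2}/swap_fun; case di : (dec i) => [[k r]|].
  by rewrite swap_fun_it -addbA addbb addbF; exact: dec_some.
by rewrite /swap_fun di.
Qed.

Definition swap_perm b : {perm 'I_n} := perm (inv_inj (swap_funK b)).

(** This ensures that a value of the estimator is correct for at most one [b]. *)
Lemma swap_perm_inj : injective swap_perm.
Proof.
move=> b b' /permP bb'; apply/ffunP => k; have := bb' (it (k, false)).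
by rewrite !permE !swap_fun_it => /it_inj [].
Qed.

End swaps.

Section bayes_risk.
Context dO (Omega : measurableType dO) (R : realType) (P : probability Omega R).
Context (n d : nat) (noise : bool -> 'I_n -> 'I_d -> Omega -> R).
Hypothesis iid : iid_std_normal P noise.
Context (sigma : 'I_n -> R).
Hypothesis sigma_gt0 : forall i, 0 < sigma i.
Context (M : nat) (it : 'I_M * bool -> 'I_n).
Hypothesis it_inj : injective it.
Context (spread : R) (al : 'I_M -> R).
Implicit Types (b : {ffun 'I_M -> bool}) (e : {ffun 'I_M * 'I_d -> bool}).
Local Notation J := (bool * 'I_n * 'I_d)%type.
Local Notation crd := (coord noise).
Local Notation phi01 := (normal_pdf 0 1).
Local Notation dec := (dec it).
Local Notation s1 k := (sigma (it (k, false))).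
Local Notation s2 k := (sigma (it (k, true))).

(** Pair [k] is centred at [spread * k], and an unpaired item [i] sits at [spread * (M + i)]; since
    k < M, no two of these centres share a multiple of [spread]. *)
Definition pert_theta e (i : 'I_n) (l : 'I_d) : R :=
  if dec i is Some (k, r)
  then pair_mean (s1 k) (s2 k) (spread * k%:R) (al k) (e (k, l)) r
  else spread * (M + i)%:R.

Let item b (j : J) := if j.1.1 then swap_perm it_inj b j.1.2 else j.1.2.

Let lik b e := lik_ratio noise (fun j => pert_theta e (item b j) j.2)
  (fun j => sigma (item b j)).

Let plik k := pair_lik noise (it (k, false)) (it (k, true)) (s1 k) (s2 k)
  (spread * k%:R) (al k).

Let rest_fac (j : J) w : R :=
  normal_pdf (spread * (M + j.1.2)%:R) (sigma j.1.2) (crd j w) / phi01 (crd j w).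

Let rest w : R := \prod_(j | dec j.1.2 == None) rest_fac j w.

Let pair_coordE k q (l : 'I_d) :
  pair_coord (it (k, false)) (it (k, true)) q l = (q.1, it (k, q.2), l).
Proof. by rewrite /pair_coord /pair_item; case: q.2. Qed.

Let pair_sdE k r : pair_sd (s1 k) (s2 k) r = sigma (it (k, r)).
Proof. by case: r. Qed.

(** Observations of unpaired items depend neither on [b] nor on [e]. The others are regrouped by
    pair and coordinate, the exchange acting as an exclusive or on the item label in the second
    sample. *)
Let lik_split b e w : lik b e w = rest w *
  \prod_(kl : 'I_M * 'I_d) \prod_(q : bool * bool)
    (normal_pdf (pair_mean (s1 kl.1) (s2 kl.1) (spread * kl.1%:R) (al kl.1) (e kl)
                   (q.2 (+) (q.1 && b kl.1)))
       (pair_sd (s1 kl.1) (s2 kl.1) (q.2 (+) (q.1 && b kl.1)))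
       (crd (pair_coord (it (kl.1, false)) (it (kl.1, true)) q kl.2) w) /
     phi01 (crd (pair_coord (it (kl.1, false)) (it (kl.1, true)) q kl.2) w)).
Proof.
rewrite /lik /lik_ratio (bigID (fun j : J => dec j.1.2 == None))/=; congr (_ * _).
  apply: eq_bigr => -[[a i] l] /= /eqP di; rewrite /rest_fac /item /=.
  have si : swap_perm it_inj b i = i by rewrite permE /swap_fun di.
  by rewrite si if_same /pert_theta di.
pose h (x : 'I_M * 'I_d * (bool * bool)) : J := (x.2.1, it (x.1.1, x.2.2), x.1.2).
pose h' (j : J) : option ('I_M * 'I_d * (bool * bool)) :=
  if dec j.1.2 is Some (k, r) then Some ((k, j.2), (j.1.1, r)) else None.
rewrite (reindex_omap h h'); last first.
  move=> [[a i] l] /=; rewrite /h' /=; case di : (dec i) => [[k r]|//] _ /=.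
  by rewrite /h/= (dec_some di).
rewrite pair_big/=; apply: eq_big => [[[k l] [a r]]|[[k l] [a r]] _].
  by rewrite /= /h' /= decK// eqxx.
rewrite pair_coordE pair_sdE /h /item /=.
have -> : (if a then swap_perm it_inj b (it (k, r)) else it (k, r)) =
    it (k, r (+) (a && b k)).
  by case: a => /=; rewrite ?addbF// permE swap_fun_it.
by rewrite /pert_theta decK.
Qed.

(** Each factor of the product over pairs and coordinates involves its own sign, so summation over
    sign patterns distributes over the product. The power of 2 undoes the averaging inside
    [coord_lik]. *)
Let sum_lik b w : \sum_e lik b e w =
  2 ^+ #|{: 'I_M * 'I_d}| * (rest w * \prod_k plik k (b k) w).
Proof.
rewrite (eq_bigr _ (fun e _ => lik_split b e w)).
rewrite -mulr_sumr mulrCA; congr (_ * _).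
rewrite -(bigA_distr_bigA (fun (kl : 'I_M * 'I_d) ee => \prod_(q : bool * bool)
    (normal_pdf (pair_mean (s1 kl.1) (s2 kl.1) (spread * kl.1%:R) (al kl.1) ee
                   (q.2 (+) (q.1 && b kl.1)))
       (pair_sd (s1 kl.1) (s2 kl.1) (q.2 (+) (q.1 && b kl.1)))
       (crd (pair_coord (it (kl.1, false)) (it (kl.1, true)) q kl.2) w) /
     phi01 (crd (pair_coord (it (kl.1, false)) (it (kl.1, true)) q kl.2) w)))).
rewrite -prodr_const /plik /pair_lik pair_big/= -big_split/=.
by apply: eq_bigr => -[k l] _; rewrite /coord_lik mulrA divff// mul1r.
Qed.

Let pset k : {set J} := pair_set d (it (k, false)) (it (k, true)).

Let rest_set : {set J} := [set j | dec j.1.2 == None]%SET.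

Let pmax k w := Num.max (plik k false w) (plik k true w).

Let it_neq k : it (k, false) != it (k, true).
Proof. by apply/eqP => /it_inj. Qed.

Let plik_ge0 k be w : 0 <= plik k be w.
Proof. exact: pair_lik_ge0. Qed.

Let pmax_ge0 k w : 0 <= pmax k w.
Proof. by rewrite le_max plik_ge0. Qed.

Let rest_ge0 w : 0 <= rest w.
Proof. by apply: prodr_ge0 => j _; rewrite divr_ge0 ?normal_pdf_ge0. Qed.

Let measurable_rest_fac (V : {set J}) j : j \in V ->
  measurable_fun setT (rest_fac j : cylType crd V -> R).
Proof.
move=> jV; apply: (measurableT_comp (f := fun x =>
  normal_pdf (spread * (M + j.1.2)%:R) (sigma j.1.2) x / phi01 x)).
  apply: measurable_funM; first exact: measurable_normal_pdf.
  exact: measurable_normal_pdf_inv.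
exact: cylinder_coord.
Qed.

Let measurable_rest : measurable_fun setT (rest : cylType crd rest_set -> R).
Proof.
rewrite (_ : rest = fun w => \prod_j (if dec j.1.2 == None then rest_fac j w else 1)).
  apply: measurable_prod => j _.
  have [jN|jN] := boolP (dec j.1.2 == None); last exact: measurable_cst.
  by apply: measurable_rest_fac; rewrite inE.
by apply/funext => w; rewrite /rest big_mkcond.
Qed.

Let integral_rest : (\int[P]_w (rest w)%:E = 1)%E.
Proof.
transitivity (\int[P]_w
    (\prod_j (if dec j.1.2 == None then rest_fac j w else 1))%:E)%E.
  by apply: eq_integral => w _; rewrite /rest big_mkcond.
rewrite (integral_indep_prod (measurable_coord iid) (coord_indep iid)
  (S := fun j => [set j]%SET)
  (F := fun j w => if dec j.1.2 == None then rest_fac j w else 1)).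
- rewrite big1// => j _.
  have [_|_] := boolP (dec j.1.2 == None); last first.
    by rewrite integral_cst//= probability_setT mule1.
  rewrite /rest_fac integral_coord//; first exact: integral_normal_pdf.
    exact: measurable_normal_pdf.
  by move=> x; exact: normal_pdf_ge0.
- by move=> j j' jj'; rewrite disjoints1 inE.
- move=> j; have [_|_] := boolP (dec j.1.2 == None).
    by apply: measurable_rest_fac; rewrite inE.
  exact: measurable_cst.
by move=> j w; case: ifP => // _; rewrite divr_ge0 ?normal_pdf_ge0.
Qed.

Let measurable_pmax k : measurable_fun setT (pmax k : cylType crd (pset k) -> R).
Proof. by apply: measurable_maxr; exact: measurable_pair_lik. Qed.

Let pset_rest k : pset k \subset (~: rest_set)%SET.
Proof.
by apply/fintype.subsetP => -[[x i] l]; rewrite !inE/= => /orP[] /eqP ->; rewrite decK.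
Qed.

Let pset_disjoint k k' : k != k' -> [disjoint pset k & pset k']%B.
Proof.
move=> kk'; rewrite disjoint_subset; apply/fintype.subsetP => -[[x i] l].
rewrite !inE/= => ik; apply: contra kk' => ik'.
have di : dec i = Some (k, i == it (k, true)).
  case/orP: ik => /eqP ->; rewrite decK//= ?eqxx//.
  by rewrite (negbTE (it_neq k)).
have di' : dec i = Some (k', i == it (k', true)).
  case/orP: ik' => /eqP ->; rewrite decK//= ?eqxx//.
  by rewrite (negbTE (it_neq k')).
by move: di; rewrite di' => -[->].
Qed.

Variable rho : R.
Hypothesis rho_ge0 : 0 <= rho.
Hypothesis rho_le : forall k,
  (rho%:E <= \int[P]_w (Num.sqrt (plik k false w * plik k true w))%:E)%E.

Let measurable_pmax_prod : measurable_fun setT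
  ((fun w => \prod_k pmax k w) : cylType crd (~: rest_set)%SET -> R).
Proof.
by apply: measurable_prod => k _; apply: (cylType_sub (pset_rest k)).
Qed.

Let integral_bound :
  (\int[P]_w (rest w * \prod_k pmax k w)%:E <= ((2 - rho ^+ 2 / 2) ^+ M)%:E)%E.
Proof.
rewrite (integral_indep2 (measurable_coord iid) (coord_indep iid)
  (S := rest_set) (S' := (~: rest_set)%SET))//; last first.
- by move=> w; exact: prodr_ge0.
- by rewrite -setI_eq0 finset.setICr.
rewrite integral_rest mul1e.
rewrite (integral_indep_prod (measurable_coord iid) (coord_indep iid) (S := pset))//.
have h (s : seq 'I_M) : (0 <= \prod_(k <- s) \int[P]_w (pmax k w)%:E)%E /\
    (\prod_(k <- s) \int[P]_w (pmax k w)%:E <=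
     ((2 - rho ^+ 2 / 2) ^+ size s)%:E)%E.
  elim: s => [|k s [h0 h]]; first by rewrite !big_nil expr0.
  have i0 : (0 <= \int[P]_w (pmax k w)%:E)%E.
    by apply: integral_ge0 => w _; rewrite lee_fin.
  rewrite !big_cons; split; first by rewrite mule_ge0.
  rewrite /= exprS EFinM; apply: lee_pmul => //.
  exact: (integral_pair_max iid (it_neq k) rho_ge0 (rho_le k)).
by have [_] := h (index_enum 'I_M); rewrite -sum1_size sum1_card card_ord.
Qed.

Variable pihat : data_space R n d -> {perm 'I_n}.
Hypothesis pihat_est : estimator pihat.

Let succ b e : set Omega := [set w |
  pihat (data noise (pert_theta e) sigma (swap_perm it_inj b) w) = swap_perm it_inj b].

Let guess b : set Omega :=
  noise_point noise @^-1` [set x | pihat x = swap_perm it_inj b].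

Let succE b e : P (succ b e) = (\int[P]_(w in guess b) (lik b e w)%:E)%E.
Proof.
apply: (law_lik_ratio iid (mean := fun j => pert_theta e (item b j) j.2)
  (sd := fun j => sigma (item b j))
  (Y := data noise (pert_theta e) sigma (swap_perm it_inj b))) => //.
by move=> -[[[] i] k] w.
Qed.

Let measurable_guess b : measurable (guess b).
Proof. by apply: (measurable_noise_point iid); exact: pihat_est. Qed.

Let measurable_lik b e : measurable_fun setT (lik b e).
Proof. exact: (measurable_lik_ratio iid). Qed.

(** At each noise point the estimator names at most one exchange, so the sum over [b] keeps at most
    one likelihood, which the product of the pairwise maxima dominates. Divided by the number of
    choices of [b] and [e], the bound is (1 - rho^2 / 4)^M. *)
Lemma sum_success_le : (\sum_b \sum_e P (succ b e) <=
  (2 ^+ #|{: 'I_M * 'I_d}| * (2 - rho ^+ 2 / 2) ^+ M)%:E)%E.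
Proof.
pose N : R := 2 ^+ #|{: 'I_M * 'I_d}|.
have N0 : 0 <= N by exact: exprn_ge0.
pose g b w := N * (rest w * \prod_k plik k (b k) w).
have gE b w : g b w = \sum_e lik b e w by rewrite sum_lik.
have lik0 b e w : 0 <= lik b e w by exact: lik_ratio_ge0.
have g0 b w : 0 <= g b w by rewrite gE sumr_ge0.
have mg b : measurable_fun setT (g b).
  by rewrite (funext (gE b)); apply: measurable_sum => e.
have sumE b : (\sum_e P (succ b e) = \int[P]_w (g b w * \1_(guess b) w)%:E)%E.
  under eq_bigr do rewrite succE.
  rewrite -ge0_integral_sum//; last 2 first.
  - by move=> e; apply/measurable_EFinP/measurable_funTS.
  - by move=> e w _; rewrite lee_fin.
  rewrite integral_mkcond; apply: eq_integral => w _.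
  rewrite patchE indicE; case: ifP => _; last by rewrite mulr0.
  by rewrite mulr1 gE sumEFin.
under eq_bigr do rewrite sumE.
rewrite -ge0_integral_sum//; last 2 first.
- move=> b; apply/measurable_EFinP; apply: measurable_funM => //.
- by move=> b w _; rewrite lee_fin mulr_ge0.
have mbound : measurable_fun setT (fun w => (rest w * \prod_k pmax k w)%:E).
  apply/measurable_EFinP; apply: measurable_funM.
    by apply: (cylType_measurable (measurable_coord iid)); exact: measurable_rest.
  by apply: (cylType_measurable (measurable_coord iid)); exact: measurable_pmax_prod.
have bound0 w : 0 <= rest w * \prod_k pmax k w.
  by rewrite mulr_ge0// prodr_ge0.
apply: (@le_trans _ _ (\int[P]_w (N%:E * (rest w * \prod_k pmax k w)%:E))%E).
  apply: ge0_le_integral => //.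
  - by move=> w _; apply: sume_ge0 => b _; rewrite lee_fin mulr_ge0.
  - apply: emeasurable_sum => b; apply/measurable_EFinP; exact: measurable_funM.
  - exact: measurable_funeM.
  move=> w _; rewrite sumEFin -EFinM lee_fin.
  have [[b wb]|nob] := pselect (exists b, guess b w); last first.
    rewrite big1 => [|b _]; first exact: mulr_ge0.
    rewrite indicE memNset ?mulr0//.
    by move=> gb; apply: nob; exists b.
  rewrite (bigD1 b)//= big1 => [|b' bb']; last first.
    rewrite indicE memNset ?mulr0// => wb'; case/eqP: bb'.
    by apply: (@swap_perm_inj _ _ _ it_inj); rewrite -wb -wb'.
  rewrite addr0 indicE mem_set// mulr1 ler_wpM2l// ler_wpM2l// ler_prod// => k _.
  by rewrite plik_ge0 /pmax le_max; case: (b k); rewrite lexx ?orbT.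
rewrite ge0_integralZl//; last by move=> w _; exact: bound0.
by rewrite EFinM lee_wpmul2l// lee_fin.
Qed.

End bayes_risk.

(** * Choice of the parameters *)

Section parameters.
Context (R : realType).

(** Two variances differ by at most max - min, which the ratio condition bounds by a multiple of the
    minimum, and the minimum is below both. *)
Lemma sigma_close (n d : nat) (sigma : 'I_n -> R) (L : R) :
  0 <= L -> (0 < d)%N -> (forall i, 0 < sigma i) ->
  sig2_max sigma / sig2_min sigma - 1 <= 4^-1 * Num.sqrt (L / d%:R) ->
  forall i j, (sigma i ^+ 2 - sigma j ^+ 2) ^+ 2 * (16 * d%:R) <=
              L * (sigma i ^+ 2 * sigma j ^+ 2).
Proof.
move=> L0 d0 s0 ratio i j.
set mx := sig2_max sigma in ratio; set mn := sig2_min sigma in ratio.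
have mxP k : sigma k ^+ 2 <= mx by exact: le_bigmax_cond.
have mnP k : mn <= sigma k ^+ 2.
  by rewrite /mn /sig2_min; apply: bigmin_le_cond.
have mx0 : 0 < mx by apply: lt_le_trans (mxP i); rewrite exprn_gt0.
(* The default value of the minimum is [mx], already known to be positive. *)
have mn0 : 0 < mn.
  rewrite /mn /sig2_min; elim/big_ind: _ => // [x y x0 y0|k _].
    by rewrite lt_min x0 y0.
  by rewrite exprn_gt0.
have dR : 0 < d%:R :> R by rewrite ltr0n.
set q := L / d%:R in ratio; have q0 : 0 <= q by rewrite divr_ge0 ?(ltW dR).
have gap : mx - mn <= mn * (4^-1 * Num.sqrt q).
  have -> : mx - mn = mn * (mx / mn - 1) by field; rewrite gt_eqF.
  by rewrite ler_pM2l.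
have gap2 : (sigma i ^+ 2 - sigma j ^+ 2) ^+ 2 <= mn ^+ 2 * (q / 16).
  have -> : mn ^+ 2 * (q / 16) = (mn * (4^-1 * Num.sqrt q)) ^+ 2.
    by rewrite !exprMn sqr_sqrtr//; field.
  rewrite -[leLHS]real_normK ?num_real// ler_pXn2r// ?nnegrE//.
    apply: le_trans gap; rewrite ler_norml.
    by have := (mxP i, mxP j, mnP i, mnP j) => -[[[h1 h2] h3] h4]; apply/andP; lra.
  by rewrite mulr_ge0 ?(ltW mn0)// mulr_ge0 ?sqrtr_ge0.
have -> : L = q * d%:R by rewrite divfK ?gt_eqF.
rewrite [leRHS](_ : _ =
    (sigma i ^+ 2 * sigma j ^+ 2 * (q / 16)) * (16 * d%:R)); last first.
  by field.
rewrite ler_wpM2r ?mulr_ge0 ?(ltW dR)//; apply: le_trans gap2 _.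
by rewrite ler_wpM2r ?divr_ge0// expr2 ler_pM ?(ltW mn0).
Qed.

(** The constants are 64 = 8^2 and 4096 = 8^4, and the factor 1 is the constant c. If the fourth
    root dominates, then L^2 <= d L, whence L <= d. A negative kappa is replaced by 0 so that powers
    preserve the order. *)
Lemma separation_regime (d : nat) (L kappa : R) : 0 <= L -> (0 < d)%N ->
  kappa < 8^-1 * Num.max (Num.sqrt L) ((1 * d%:R * L) `^ (4^-1)) ->
  let a := Num.max kappa 0 ^+ 2 / d%:R in
  a <= L / (64 * d%:R) \/ (a ^+ 2 <= L / (4096 * d%:R) /\ L <= d%:R).
Proof.
move=> L0 d0 hk a; have dR : 0 < d%:R :> R by rewrite ltr0n.
set r := (1 * d%:R * L) `^ (4^-1) in hk; set k0 := Num.max kappa 0 in a *.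
have k00 : 0 <= k0 by rewrite le_max lexx orbT.
have r0 : 0 <= r by exact: powR_ge0.
have r4 : r ^+ 4 = d%:R * L.
  by rewrite /r -powR_mulrn// -powRrM mulVf// powRr1 mul1r// mulr_ge0// ltW.
have k0le : k0 <= 8^-1 * Num.max (Num.sqrt L) r.
  by rewrite ge_max (ltW hk)/= mulr_ge0// le_max sqrtr_ge0.
have sL2 : Num.sqrt L ^+ 2 = L by rewrite sqr_sqrtr.
have [rs|sr] := leP r (Num.sqrt L).
  left; rewrite /a ler_pdivrMr// (_ : L / (64 * d%:R) * d%:R = L / 64); last first.
    by field; rewrite gt_eqF.
  move: k0le; rewrite max_l// => k0le.
  have := ler_pXn2r (n := 2) isT k00 (le_trans k00 k0le).
  rewrite k0le exprMn sL2 => /esym; lra.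
right; move: k0le; rewrite max_r ?(ltW sr)// => k0le.
have k04 : k0 ^+ 4 <= d%:R * L / 4096.
  have : k0 ^+ 4 <= (8^-1 * r) ^+ 4 by rewrite ler_pXn2r// nnegrE mulr_ge0.
  by rewrite exprMn r4 => /le_trans; apply; rewrite -subr_ge0; lra.
split.
  rewrite /a expr_div_n -exprM ler_pdivrMr ?exprn_gt0//.
  rewrite (_ : L / (4096 * d%:R) * d%:R ^+ 2 = d%:R * L / 4096)//.
  by field; rewrite gt_eqF.
have : Num.sqrt L ^+ 4 <= r ^+ 4 by rewrite ler_pXn2r ?nnegrE ?sqrtr_ge0// ltW.
rewrite r4 (exprM _ 2 2) sL2 expr2.
have [->|Lneq0] := eqVneq L 0; first by rewrite (ltW dR).
by rewrite ler_pM2r// lt_def Lneq0.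
Qed.

End parameters.

(** * Separation of the perturbed means *)

Section separation.
Context (R : realType) (n d M : nat) (sigma : 'I_n -> R) (it : 'I_M * bool -> 'I_n).
Hypotheses (d_gt0 : (0 < d)%N) (sigma_gt0 : forall i, 0 < sigma i).
Hypothesis it_inj : injective it.
Context (k0 : R).
Hypothesis k0_ge0 : 0 <= k0.
Local Notation s1 k := (sigma (it (k, false))).
Local Notation s2 k := (sigma (it (k, true))).

(** In each of the [d] coordinates the items of a pair differ by this number times the sum of their
    variances; the Euclidean distance is then [k0] times the root of that sum. *)
Definition pert_scale (k : 'I_M) : R :=
  k0 / Num.sqrt (d%:R * (s1 k ^+ 2 + s2 k ^+ 2)).

Let dR : 0 < d%:R :> R. Proof. by rewrite ltr0n. Qed.

Let S_gt0 k : 0 < s1 k ^+ 2 + s2 k ^+ 2.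
Proof. by rewrite addr_gt0 ?exprn_gt0. Qed.

Lemma pert_scaleE k :
  pert_scale k ^+ 2 * (s1 k ^+ 2 + s2 k ^+ 2) = k0 ^+ 2 / d%:R.
Proof.
rewrite expr_div_n sqr_sqrtr ?mulr_ge0 ?(ltW dR) ?(ltW (S_gt0 k))//.
by field; rewrite !gt_eqF.
Qed.

Let pert_max : R := \sum_k `|pert_scale k| * (s1 k ^+ 2 + s2 k ^+ 2).

(** The first term absorbs the perturbations of two items; the second leaves the distance required
    between items of different clusters. *)
Definition pert_spread : R := 2 * pert_max + 2 * (k0 * \sum_i sigma i).

(** Cluster number: the two items of a pair share one, and unpaired items get distinct ones from [M]
    on. *)
Let code (i : 'I_n) : nat := if dec it i is Some (k, _) then k else (M + i)%N.

Let pert_dist e i (l : 'I_d) :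
  `|pert_theta sigma it pert_spread pert_scale e i l - pert_spread * (code i)%:R|
  <= pert_max.
Proof.
have sum_ge0 (A : {pred 'I_M}) :
    0 <= \sum_(k in A) `|pert_scale k| * (s1 k ^+ 2 + s2 k ^+ 2).
  by apply: sumr_ge0 => k _; rewrite mulr_ge0// ltW.
rewrite /pert_theta /code; case: (dec it i) => [[k r]|]; last first.
  by rewrite subrr normr0; exact: (sum_ge0 predT).
have norm_pert (e1 e2 : bool) (p s : R) :
    `|sgb R e1 * sgb R e2 * p * s ^+ 2| = `|p| * s ^+ 2.
  by rewrite !normrM /sgb !normr_sign !mul1r -expr2 real_normK ?num_real.
rewrite /pair_mean addrC addKr norm_pert.
rewrite /pert_max (bigD1 k)//= -[leLHS]addr0 lerD//; last exact: (sum_ge0 (predC1 k)).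
rewrite ler_wpM2l//.
by case: r; rewrite /pair_sd ?lerDl ?lerDr sqr_ge0.
Qed.

Let code_eq i j : i != j -> code i = code j ->
  exists k r, i = it (k, r) /\ j = it (k, ~~ r).
Proof.
rewrite /code; case di : (dec it i) => [[k r]|]; case dj : (dec it j) => [[k' r']|].
- move=> ij /ord_inj kk'; exists k, r; rewrite -(dec_some di) -(dec_some dj) -kk'.
  split=> //; congr (it (_, _)); apply: contraNeq ij; rewrite -(dec_some di).
  by rewrite -(dec_some dj) -kk'; case: r {di}; case: r' {dj}.
- by move=> _ kj; have := ltn_ord k; rewrite kj ltnNge leq_addr.
- by move=> _ ki; have := ltn_ord k'; rewrite -ki ltnNge leq_addr.
by move=> /eqP ij /addnI /ord_inj.
Qed.

Let pair_distance e k r :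
  eucl_norm (fun l : 'I_d => pert_theta sigma it pert_spread pert_scale e (it (k, r)) l
                 - pert_theta sigma it pert_spread pert_scale e (it (k, ~~ r)) l) =
  k0 * Num.sqrt (sigma (it (k, r)) ^+ 2 + sigma (it (k, ~~ r)) ^+ 2).
Proof.
have -> : sigma (it (k, r)) ^+ 2 + sigma (it (k, ~~ r)) ^+ 2 = s1 k ^+ 2 + s2 k ^+ 2.
  by case: r => //=; rewrite addrC.
rewrite /eucl_norm (eq_bigr (fun=> k0 ^+ 2 / d%:R * (s1 k ^+ 2 + s2 k ^+ 2))).
  rewrite sumr_const card_ord -[X in Num.sqrt X]mulr_natr.
  rewrite [X in Num.sqrt X](_ : _ = k0 ^+ 2 * (s1 k ^+ 2 + s2 k ^+ 2)); last first.
    by field; rewrite gt_eqF.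
  by rewrite sqrtrM ?sqr_ge0// sqrtr_sqr ger0_norm.
move=> l _; rewrite /pert_theta !decK// /pair_mean -(pert_scaleE k) /sgb.
have sq1 : ((-1) ^+ e (k, l)) ^+ 2 = 1 :> R by rewrite sqrr_sign.
rewrite [LHS](_ : _ = ((-1) ^+ e (k, l)) ^+ 2 * (pert_scale k ^+ 2 *
   (s1 k ^+ 2 + s2 k ^+ 2) ^+ 2)); last first.
  by case: r; rewrite /pair_sd /= ?(expr0, expr1); ring.
by rewrite sq1; ring.
Qed.

(** Different codes put the centres at least [pert_spread] apart in every coordinate, so a single
    coordinate already gives the required distance. *)
Let far_distance e i j : code i != code j ->
  k0 * Num.sqrt (sigma i ^+ 2 + sigma j ^+ 2) <=
  eucl_norm (fun l : 'I_d => pert_theta sigma it pert_spread pert_scale e i l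
                           - pert_theta sigma it pert_spread pert_scale e j l).
Proof.
move=> cij; pose l0 := Ordinal d_gt0.
set v := fun l => _; have vn : `|v l0| <= eucl_norm v.
  rewrite -sqrtr_sqr ler_sqrt; last by apply: sumr_ge0 => *; exact: sqr_ge0.
  by rewrite (bigD1 l0)//= lerDl; apply: sumr_ge0 => *; exact: sqr_ge0.
apply: le_trans vn.
have si h : sigma h <= \sum_i sigma i.
  by rewrite (bigD1 h)//= lerDl; apply: sumr_ge0 => *; rewrite ltW.
have sum_ge0 : 0 <= \sum_i sigma i by apply: le_trans (si i); rewrite ltW.
have sq : Num.sqrt (sigma i ^+ 2 + sigma j ^+ 2) <= 2 * \sum_i sigma i.
  rewrite -[leRHS]ger0_norm ?mulr_ge0// -sqrtr_sqr ler_sqrt ?sqr_ge0//.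
  have := si i; have := si j; have := sigma_gt0 i; have := sigma_gt0 j.
  by move: (sigma i) (sigma j) (\sum_i _) => x y z; nra.
apply: le_trans (ler_wpM2l k0_ge0 sq) _.
have codes : 1 <= `|(code i)%:R - (code j)%:R : R|.
  case: (ltngtP (code i) (code j)) cij => // h _.
    rewrite distrC ger0_norm; last by rewrite subr_ge0 ler_nat ltnW.
    by rewrite lerBrDr -(natrD R 1) ler_nat.
  rewrite ger0_norm; last by rewrite subr_ge0 ler_nat ltnW.
  by rewrite lerBrDr -(natrD R 1) ler_nat.
have spread0 : 0 <= pert_spread.
  rewrite addr_ge0// mulr_ge0//; last by rewrite mulr_ge0.
  by apply: sumr_ge0 => k _; rewrite mulr_ge0// ltW.
have base : pert_spread <= `|pert_spread * (code i)%:R - pert_spread * (code j)%:R|.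
  by rewrite -mulrBr normrM (ger0_norm spread0) ler_peMr.
have := pert_dist e i l0; have := pert_dist e j l0; move: base; rewrite /v.
move: (pert_theta _ _ _ _ _ _ _) (pert_theta _ _ _ _ _ _ _) => y x.
move: (_ * (code i)%:R) (_ * (code j)%:R) => ci cj base hy hx.
have tri : `|ci - cj| <= `|y - x| + `|y - ci| + `|x - cj|.
  rewrite [ci - cj](_ : _ = (y - x) - (y - ci) + (x - cj)); last by ring.
  by rewrite (le_trans (ler_normD _ _))// lerD2r ler_normB.
move: base tri hy hx; rewrite /pert_spread; lra.
Qed.

Lemma pert_theta_separated e :
  Theta_bar (d := d) sigma k0 (pert_theta sigma it pert_spread pert_scale e).
Proof.
rewrite /Theta_bar /kappa_bar /=; apply: le_bigmin; first by rewrite leey.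
move=> [i j] /= ij; have sij : 0 < Num.sqrt (sigma i ^+ 2 + sigma j ^+ 2).
  by rewrite sqrtr_gt0 addr_gt0 ?exprn_gt0.
rewrite lee_fin ler_pdivlMr//.
have [cij|cij] := eqVneq (code i) (code j); last exact: far_distance.
by have [k [r [-> ->]]] := code_eq ij cij; rewrite pair_distance.
Qed.

End separation.

(** * From average success to a constant probability of error *)

Section success_bound.
Context (R : realType).

(** (1 - 1/(4n))^M <= exp(-M/(4n)) <= exp(-1/12) <= 12/13, where M/n >= 1/3 gives the middle
    step. *)
Lemma pow_success_le (n M : nat) : (0 < n)%N -> (n <= 3 * M)%N ->
  (2 - n%:R^-1 / 2) ^+ M <= 2 ^+ M * (12 / 13) :> R.
Proof.
move=> n0 nM; have nR : 0 < n%:R :> R by rewrite ltr0n.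
have -> : 2 - n%:R^-1 / 2 = 2 * (1 - (4 * n%:R)^-1) :> R.
  by field; rewrite gt_eqF.
rewrite exprMn ler_wpM2l ?exprn_ge0//.
apply: (@le_trans _ _ (expR (- (4 * n%:R)^-1) ^+ M)).
  apply: lerXn2r; rewrite ?nnegrE ?expR_ge0//; last exact: expR_ge1Dx.
  rewrite subr_ge0 invf_le1 ?mulr_gt0//.
  by rewrite -(natrM R 4) (ler_nat R 1) muln_gt0.
rewrite -expRM_natl mulrN expRN.
have nM' : n%:R <= 3 * M%:R :> R by rewrite -(natrM R 3) ler_nat.
have : 12^-1 <= M%:R * (4 * n%:R)^-1 :> R.
  by rewrite ler_pdivlMr ?mulr_gt0//; lra.
move=> h; have e : 13 / 12 <= expR (M%:R * (4 * n%:R)^-1) :> R.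
  by apply: le_trans (expR_ge1Dx _); lra.
rewrite (_ : 12 / 13 = (13 / 12)^-1 :> R); last by rewrite invf_div.
by rewrite lef_pV2 ?posrE ?expR_gt0 ?divr_gt0.
Qed.

(** If all the success probabilities were at least 27/28, so would be their average, which [q]
    bounds. *)
Lemma exists_unlikely_success (K1 K2 : finType) (p : K1 -> K2 -> \bar R) (q : R) :
  (0 < #|K1|)%N -> (0 < #|K2|)%N -> q < 27 / 28 ->
  (\sum_b \sum_e p b e <= (#|K2|%:R * (#|K1|%:R * q))%:E)%E ->
  exists b e, (p b e < (27 / 28)%:E)%E.
Proof.
move=> K1_gt0 K2_gt0 q_lt sum_le; apply: contrapT => none.
have p_ge b e : ((27 / 28)%:E <= p b e)%E.
  by rewrite leNgt; apply/negP => pbe; apply: none; exists b, e.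
have : (\sum_(b : K1) \sum_(e : K2) (27 / 28 : R)%:E <= \sum_b \sum_e p b e)%E.
  by apply: lee_sum => b _; apply: lee_sum.
move=> /le_trans/(_ sum_le).
under eq_bigr do rewrite sumEFin.
rewrite sumEFin lee_fin !sumr_const -[X in X <= _]mulr_natl.
rewrite -[X in _ * X <= _]mulr_natl mulrCA.
by rewrite !ler_pM2l ?ltr0n// leNgt q_lt.
Qed.

End success_bound.

Section pairing.
Variable n : nat.

Lemma leq_triple_half : (6 <= n)%N -> (n <= 3 * n./2)%N.
Proof.
move=> n6; have half3 : (3 <= n./2)%N by exact: (half_leq n6).
rewrite -[leqLHS](odd_double_half n) -addnn mulSn mul2n -addnn leq_add2r.
exact: leq_trans (leq_b1 _) (leq_trans _ half3).
Qed.

Lemma pair_index_lt (kr : 'I_(n./2) * bool) : (kr.1.*2 + kr.2 < n)%N.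
Proof.
case: kr => k r /=; have k_lt := ltn_ord k.
have half_le : (n./2.*2 <= n)%N by rewrite -{2}(odd_double_half n) leq_addl.
apply: leq_trans half_le; apply: (@leq_trans k.+1.*2); last by rewrite leq_double.
by rewrite doubleS; case: r; rewrite ?addn1 ?addn0.
Qed.

(** Consecutive items are paired; when n is odd the last one stays unpaired. *)
Definition pair_index (kr : 'I_(n./2) * bool) : 'I_n := Ordinal (pair_index_lt kr).

Lemma pair_index_inj : injective pair_index.
Proof.
move=> [k r] [k' r'] /(congr1 val) /= kr; congr pair.
  apply: ord_inj; have := congr1 half kr.
  by rewrite ![(_ + nat_of_bool _)%N]addnC !half_bit_double.
by have := congr1 odd kr; rewrite !oddD !odd_double !oddb.
Qed.

End pairing.

(** * The minimax lower bound, assembled with c = 1 and C = 1/29 *)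

Theorem theorem4 (R : realType) :
  exists c C : R, 0 < c /\ 0 < C /\
  forall (n d : nat) (sigma : 'I_n -> R) (kappa : R),
    (6 <= n)%N -> (1 <= d)%N ->
    (forall i, 0 < sigma i) ->
    sig2_max sigma / sig2_min sigma - 1 <= 4^-1 * Num.sqrt (ln (n%:R) / d%:R) ->
    kappa < 8^-1 * Num.max (Num.sqrt (ln (n%:R)))
                            ((c * d%:R * ln (n%:R)) `^ (4^-1)) ->
    forall (dO : measure_display) (Omega : measurableType dO)
           (P : probability Omega R) (noise : bool -> 'I_n -> 'I_d -> Omega -> R),
      iid_std_normal P noise ->
      (C%:E < minimax_risk P noise sigma kappa)%E.
Proof.
exists 1, (29^-1); split=> //; split; first by rewrite invr_gt0.
move=> n d sigma kappa n6 d_gt0 sigma_gt0 ratio kappa_lt dO Omega P noise iid.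
have n_gt0 : (0 < n)%N by exact: leq_trans n6.
have nR : 0 < n%:R :> R by rewrite ltr0n.
have dR : 0 < d%:R :> R by rewrite ltr0n.
set L := ln n%:R in ratio kappa_lt.
have L_ge0 : 0 <= L by rewrite ln_ge0// (ler_nat R 1).
(* Means separated by [k0] are also separated by [kappa], and [k0] is nonnegative, as a distance
   must be. *)
pose k0 := Num.max kappa 0; have k0_ge0 : 0 <= k0 by rewrite le_max lexx orbT.
pose it := @pair_index n; have it_inj : injective it := @pair_index_inj n.
pose al := pert_scale d sigma it k0; pose spread := pert_spread d sigma it k0.
(* Chosen so that the affinity r^d over all coordinates has square 1/n. *)
pose r := expR (- (L / (2 * d%:R))).
have close i j := sigma_close L_ge0 d_gt0 sigma_gt0 ratio i j.
have regime := separation_regime L_ge0 d_gt0 kappa_lt.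
have it_neq k : it (k, false) != it (k, true) by apply/eqP => /it_inj.
have r_le k l : (r%:E <= \int[P]_w (Num.sqrt (
    coord_lik noise (it (k, false)) (it (k, true)) (sigma (it (k, false)))
      (sigma (it (k, true))) (spread * k%:R) (al k) false l w *
    coord_lik noise (it (k, false)) (it (k, true)) (sigma (it (k, false)))
      (sigma (it (k, true))) (spread * k%:R) (al k) true l w))%:E)%E.
  have alE : al k ^+ 2 * (sigma (it (k, false)) ^+ 2 + sigma (it (k, true)) ^+ 2) =
    k0 ^+ 2 / d%:R by exact: pert_scaleE.
  (* The bound by one cosine serves the regime of log n, the polynomial bound that of d log n. *)
  have [low|[high LD]] := regime.
    apply: le_trans (affinity_ge_exp iid _ _ (it_neq k) _ _ l) => //.
    by rewrite lee_fin exp_le_affinity_low ?alE.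
  apply: le_trans (affinity_ge_gap iid _ _ (it_neq k) _ _ l) => //.
  by rewrite lee_fin exp_le_affinity_gap ?alE.
have r_ge0 : 0 <= r by exact: expR_ge0.
have rho2 : (r ^+ d) ^+ 2 = n%:R^-1.
  rewrite -exprM mulnC exprM -!expRM_natl.
  rewrite (_ : _ * _ = - L); last by field; rewrite gt_eqF.
  by rewrite expRN lnK.
(* Every estimator errs with probability at least 1/28 somewhere; passing to the infimum keeps only
   a weak inequality, and the smaller constant 1/29 restores strictness. *)
apply: (@lt_le_trans _ _ (28^-1)%:E).
  by rewrite lte_fin ltf_pV2 ?posrE// ltr_nat.
apply/ereal_infP => _ [pihat est <-].
have sum_le := sum_success_le iid sigma_gt0 it_inj (spread := spread) (al := al)
  (exprn_ge0 d r_ge0) (fun k => pair_affinity iid r_ge0 (r_le k)) est.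
have [b [e succ]] : exists b e, (P [set w |
    pihat (data noise (pert_theta sigma it spread al e) sigma (swap_perm it_inj b) w) =
    swap_perm it_inj b] < (27 / 28)%:E)%E.
  apply: (exists_unlikely_success (q := 12 / 13)).
  - by apply/card_gt0P; exists [ffun=> false].
  - by apply/card_gt0P; exists [ffun=> false].
  - by lra.
  apply: le_trans sum_le _; rewrite lee_fin !card_ffun !card_bool card_ord rho2.
  rewrite !natrX ler_wpM2l ?exprn_ge0// pow_success_le//.
  exact: leq_triple_half.
have msucc : measurable [set w |
    pihat (data noise (pert_theta sigma it spread al e) sigma (swap_perm it_inj b) w) =
    swap_perm it_inj b].
  apply: (measurable_obs (Y := data noise (pert_theta sigma it spread al e) sigma
     (swap_perm it_inj b))) (est (swap_perm it_inj b)) => j.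
  rewrite (_ : (fun w => _) = fun w =>
    pert_theta sigma it spread al e
      (if j.1.1 then swap_perm it_inj b j.1.2 else j.1.2) j.2 +
    sigma (if j.1.1 then swap_perm it_inj b j.1.2 else j.1.2) * coord noise j w).
    apply: measurable_funD => //; apply: measurable_funM => //.
    exact: (measurable_coord iid).
  by apply/funext => w; case: j => [[[] i] l].
(* The unlikely success provides both witnesses: its exchange enters the maximum over permutations,
   its means the supremum. *)
apply: (@le_trans _ _ (err_prob P noise pihat (pert_theta sigma it spread al e) sigma
  (swap_perm it_inj b))).
  rewrite /err_prob (_ : [set w | _] = ~` [set w |
    pihat (data noise (pert_theta sigma it spread al e) sigma (swap_perm it_inj b) w) =
    swap_perm it_inj b]); last first.
    by apply/seteqP; split => w /= /eqP.
  rewrite probability_setC// leeBrDr ?fin_num_measure//.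
  apply: le_trans (leeD2l _ (ltW succ)) _.
  by rewrite -EFinD lee_fin; lra.
apply: le_trans (le_bigmax_cond _ _ (isT : xpredT (swap_perm it_inj b))).
apply: ereal_sup_ubound; exists (pert_theta sigma it spread al e) => //.
apply: le_trans (pert_theta_separated d_gt0 sigma_gt0 it_inj k0_ge0 e).
by rewrite lee_fin le_max lexx.
Qed.
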